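(* Let $(\mathcal{C},\otimes,I,C)$ be a braided tensor category in which any two parallel morphisms have an equaliser and a coequaliser. Let $H$ be a Hopf algebra in $\mathcal{C}$ and let $A$ and $B$ be algebras in $\mathcal{C}$. Then the following assertions are equivalent: (i) There exist a weak action $\alpha: H\otimes B\to B$ of $H$ on $B$ and a convolution-invertible 2-cocycle $\sigma: H\otimes H\to B$ (with respect to $\alpha$) such that $B\#_\sigma H$ is a crossed product algebra (i.e. an algebra in $\mathcal{C}$ with unit $\eta_B\otimes\eta_H$) and $A = B\#_\sigma H$ (identified by an isomorphism of algebras in $\mathcal{C}$). (ii) There exists a morphism $\psi: A\to A\otimes H$ making $(A,\psi)$ a right $H$-comodule algebra with $B=A^{co H}$ (i.e. there is an algebra morphism $p: B\to A$ such that $(B,p)$ is the equaliser of $\psi$ and $\mathrm{id}_A\otimes\eta_H$), the extension $A/B$ is Galois, the canonical epimorphism $q: A\otimes A\to A\otimes_B A$ is split, and $A$ is isomorphic in $\mathcal{C}$, as a left $B$-module and right $H$-comodule, to $B\otimes H$, where $B\otimes H$ has right $H$-comodule structure $\psi_{B\otimes H}=\mathrm{id}_B\otimes\Delta_H$ and left $B$-module structure $\alpha_{B\otimes H}=m_B\otimes \mathrm{id}_H$.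
   Context: Conventions: $C$ denotes the braiding and $I$ the unit object; associativity and unit constraints are suppressed; an object written in a tensor product of morphisms stands for its identity, e.g. $W\otimes f$ means $\mathrm{id}_W\otimes f$. Composition is written by juxtaposition. For an algebra $X$ in $\mathcal{C}$ (associative, unital), $m_X,\eta_X$ are multiplication and unit. $H$ is a braided Hopf algebra with multiplication $m=m_H$, unit $\eta_H$, comultiplication $\Delta_H$, counit $\epsilon_H$ and antipode $S$. Right $H$-comodule algebra: an algebra $A$ with a right $H$-comodule structure $\psi:A\to A\otimes H$ such that $\psi m_A=(m_A\otimes m_H)(A\otimes C\otimes H)(\psi\otimes\psi)$ and $\psi\eta_A=\eta_A\otimes\eta_H$. Coinvariants: $(A^{coH},p)$ is the equaliser of $\psi$ and $\mathrm{id}_A\otimes\eta_H: A\to A\otimes H$; $A^{coH}$ is an algebra with the structure making the monomorphism $p:A^{coH}\to A$ an algebra morphism. With $B=A^{coH}$, $A$ is a left $B$-module via $m_A(p\otimes A)$, and $(A\otimes_B A,q)$ is the coequaliser of $(m_A\otimes A)(A\otimes p\otimes A)$ and $(A\otimes m_A)(A\otimes p\otimes A): A\otimes B\otimes A\to A\otimes A$; $q: A\otimes A\to A\otimes_BA$ is the canonical epimorphism. It is split if there is a morphism $w: A\otimes_BA\to A\otimes A$ with $qw=\mathrm{id}$. Galois: put $can'=(m_A\otimes H)(A\otimes\psi):A\otimes A\to A\otimes H$. The extension $A/A^{coH}$ is Galois if there is an isomorphism $can: A\otimes_{A^{coH}}A\to A\otimes H$ in $\mathcal{C}$ with $can\circ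 q=can'$. Weak action: a morphism $\alpha:H\otimes B\to B$ is a weak action of $H$ on the algebra $B$ if $\alpha(H\otimes m_B)=m_B(\alpha\otimes\alpha)(H\otimes C\otimes B)(\Delta_H\otimes B\otimes B)$ and $\alpha(H\otimes\eta_B)=\eta_B\epsilon_H$. 2-cocycle: a morphism $\sigma:H\otimes H\to B$ is a 2-cocycle (with respect to $\alpha$) if $$m_B(\alpha\otimes\sigma)(H\otimes C\otimes H)(H\otimes H\otimes\sigma\otimes m)(H\otimes H\otimes H\otimes C\otimes H)(\Delta_H\otimes\Delta_H\otimes\Delta_H)$$ $$= m_B(B\otimes\sigma)(\sigma\otimes m\otimes H)(H\otimes C\otimes H\otimes H)(\Delta_H\otimes\Delta_H\otimes H)$$ and $\sigma(H\otimes\eta_H)=\sigma(\eta_H\otimes H)=\eta_B\epsilon_H$. It is invertible if it is convolution-invertible: there is $\omega:H\otimes H\to B$ with $m_B(\sigma\otimes\omega)(H\otimes C\otimes H)(\Delta_H\otimes\Delta_H)=\eta_B(\epsilon_H\otimes\epsilon_H)=m_B(\omega\otimes\sigma)(H\otimes C\otimes H)(\Delta_H\otimes\Delta_H)$. Crossed product: $B\#_\sigma H$ is the object $B\otimes H$ with multiplication $$m_{B\#_\sigma H}=(m_B\otimes H)(m_B\otimes\sigma\otimes m_H)(B\otimes B\otimes H\otimes C\otimes H)(B\otimes\alpha\otimes\Delta_H\otimes\Delta_H)(B\otimes H\otimes C\otimes H)(B\otimes\Delta_H\otimes B\otimes H)$$ and unit $\eta_B\otimes\eta_H$. It is called a crossed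 product algebra when these make it an (associative, unital) algebra in $\mathcal{C}$. *)

(* Defs.v *)
Set Implicit Arguments.
Unset Strict Implicit.
Unset Printing Implicit Defensive.

Declare Scope cat_scope.
Delimit Scope cat_scope with cat.
Open Scope cat_scope.

(** * Categories *)

Record category := Category {
  ob :> Type;
  hom : ob -> ob -> Type;
  idm : forall x, hom x x;
  comp : forall x y z, hom y z -> hom x y -> hom x z;
  comp1m : forall x y (f : hom x y), comp (idm y) f = f;
  compm1 : forall x y (f : hom x y), comp f (idm x) = f;
  compA : forall x y z t (f : hom z t) (g : hom y z) (h : hom x y),
    comp f (comp g h) = comp (comp f g) h
}.

Arguments hom {c} x y.
Arguments idm {c} x.
Arguments comp {c x y z} g f.

Notation "x ~> y" := (hom x y) (at level 70, no associativity) : cat_scope.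
Notation "'\id' x" := (idm x) (at level 10, x at level 9) : cat_scope.
Notation "g ∘ f" := (comp g f) (at level 45, right associativity) : cat_scope.

Section Categorical.
Variable C : category.
Implicit Types x y e z : C.

Definition is_iso x y (f : x ~> y) : Prop :=
  exists g : y ~> x, g ∘ f = \id x /\ f ∘ g = \id y.

Definition is_split_epi x y (f : x ~> y) : Prop :=
  exists g : y ~> x, f ∘ g = \id y.

Definition is_equaliser x y (f g : x ~> y) e (i : e ~> x) : Prop :=
  f ∘ i = g ∘ i /\
  forall z (h : z ~> x), f ∘ h = g ∘ h -> exists! k : z ~> e, i ∘ k = h.

Definition is_coequaliser x y (f g : x ~> y) e (q : y ~> e) : Prop :=
  q ∘ f = q ∘ g /\
  forall z (h : y ~> z), h ∘ f = h ∘ g -> exists! k : e ~> z, k ∘ q = h.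

Definition has_equalisers : Prop :=
  forall x y (f g : x ~> y), exists e (i : e ~> x), is_equaliser f g i.

Definition has_coequalisers : Prop :=
  forall x y (f g : x ~> y), exists e (q : y ~> e), is_coequaliser f g q.

End Categorical.

(** * Braided monoidal categories (not assumed to be strict) *)

Record monoidal_category := MonoidalCategory {
  mon_cat :> category;
  unit_ob : mon_cat;
  tens : mon_cat -> mon_cat -> mon_cat;
  tensm : forall x y x' y' : mon_cat,
    x ~> y -> x' ~> y' -> tens x x' ~> tens y y';
  tensm_id : forall x y : mon_cat, tensm (\id x) (\id y) = \id (tens x y);
  tensm_comp : forall (x y z x' y' z' : mon_cat)
    (g : y ~> z) (f : x ~> y) (g' : y' ~> z') (f' : x' ~> y'),
    tensm (g ∘ f) (g' ∘ f') = tensm g g' ∘ tensm f f';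
  assoc : forall x y z : mon_cat, tens (tens x y) z ~> tens x (tens y z);
  assocV : forall x y z : mon_cat, tens x (tens y z) ~> tens (tens x y) z;
  assocK : forall x y z, assocV x y z ∘ assoc x y z = \id (tens (tens x y) z);
  assocVK : forall x y z, assoc x y z ∘ assocV x y z = \id (tens x (tens y z));
  assoc_natural : forall (x y z x' y' z' : mon_cat)
    (f : x ~> x') (g : y ~> y') (h : z ~> z'),
    assoc x' y' z' ∘ tensm (tensm f g) h = tensm f (tensm g h) ∘ assoc x y z;
  lunit : forall x : mon_cat, tens unit_ob x ~> x;
  lunitV : forall x : mon_cat, x ~> tens unit_ob x;
  lunitK : forall x, lunitV x ∘ lunit x = \id (tens unit_ob x);
  lunitVK : forall x, lunit x ∘ lunitV x = \id x;
  lunit_natural : forall (x y : mon_cat) (f : x ~> y),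
    lunit y ∘ tensm (\id unit_ob) f = f ∘ lunit x;
  runit : forall x : mon_cat, tens x unit_ob ~> x;
  runitV : forall x : mon_cat, x ~> tens x unit_ob;
  runitK : forall x, runitV x ∘ runit x = \id (tens x unit_ob);
  runitVK : forall x, runit x ∘ runitV x = \id x;
  runit_natural : forall (x y : mon_cat) (f : x ~> y),
    runit y ∘ tensm f (\id unit_ob) = f ∘ runit x;
  pentagon : forall x y z t : mon_cat,
    assoc x y (tens z t) ∘ assoc (tens x y) z t =
    tensm (\id x) (assoc y z t) ∘ assoc x (tens y z) t
      ∘ tensm (assoc x y z) (\id t);
  triangle : forall x y : mon_cat,
    tensm (\id x) (lunit y) ∘ assoc x unit_ob y = tensm (runit x) (\id y)
}.

Arguments unit_ob {m}.
Arguments tens {m} x y.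
Arguments tensm {m x y x' y'} f g.
Arguments assoc {m} x y z.
Arguments assocV {m} x y z.
Arguments lunit {m} x.
Arguments lunitV {m} x.
Arguments runit {m} x.
Arguments runitV {m} x.

(* [⊗] is the tensor product of objects, [⊠] the one of morphisms. *)
Notation "x ⊗ y" := (tens x y) (at level 40, left associativity) : cat_scope.
Notation "f ⊠ g" := (tensm f g) (at level 40, left associativity) : cat_scope.
Notation "'\I'" := unit_ob : cat_scope.

Record braided_category := BraidedCategory {
  br_mon :> monoidal_category;
  braid : forall x y : br_mon, x ⊗ y ~> y ⊗ x;
  braidV : forall x y : br_mon, y ⊗ x ~> x ⊗ y;
  braidK : forall x y, braidV x y ∘ braid x y = \id (x ⊗ y);
  braidVK : forall x y, braid x y ∘ braidV x y = \id (y ⊗ x);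
  braid_natural : forall (x y x' y' : br_mon) (f : x ~> x') (g : y ~> y'),
    braid x' y' ∘ (f ⊠ g) = (g ⊠ f) ∘ braid x y;
  hexagon1 : forall x y z : br_mon,
    assoc y z x ∘ braid x (y ⊗ z) ∘ assoc x y z =
    (\id y ⊠ braid x z) ∘ assoc y x z ∘ (braid x y ⊠ \id z);
  hexagon2 : forall x y z : br_mon,
    assocV z x y ∘ braid (x ⊗ y) z ∘ assocV x y z =
    (braid x z ⊠ \id y) ∘ assocV x z y ∘ (\id x ⊠ braid y z)
}.

Arguments braid {b} x y.
Arguments braidV {b} x y.

(* [W ⊗ C_{X,Y} ⊗ Z]; all the braidings in the formulas below occur in
   this form. *)
Definition interchange (C : braided_category) (W X Y Z : C) :
    (W ⊗ X) ⊗ (Y ⊗ Z) ~> (W ⊗ Y) ⊗ (X ⊗ Z) :=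
  assocV W Y (X ⊗ Z)
  ∘ (\id W ⊠ (assoc Y X Z ∘ (braid X Y ⊠ \id Z) ∘ assocV X Y Z))
  ∘ assoc W X (Y ⊗ Z).

(** * Algebras *)

Record is_algebra (C : monoidal_category) (X : C)
    (m : X ⊗ X ~> X) (u : \I ~> X) : Prop := IsAlgebra {
  algA : m ∘ (m ⊠ \id X) = m ∘ (\id X ⊠ m) ∘ assoc X X X;
  alg1m : m ∘ (u ⊠ \id X) = lunit X;
  algm1 : m ∘ (\id X ⊠ u) = runit X
}.

Record algebra (C : monoidal_category) := Algebra {
  alg_ob :> C;
  mul : alg_ob ⊗ alg_ob ~> alg_ob;
  one : \I ~> alg_ob;
  algP : is_algebra mul one
}.

Arguments mul {C} a.
Arguments one {C} a.

Definition is_algebra_morphism (C : monoidal_category) (X Y : algebra C)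
    (f : X ~> Y) : Prop :=
  f ∘ mul X = mul Y ∘ (f ⊠ f) /\ f ∘ one X = one Y.

Definition algebra_isomorphic (C : monoidal_category) (X Y : algebra C) : Prop :=
  exists f : X ~> Y, is_algebra_morphism f /\ is_iso f.

(** * Hopf algebras *)

Record hopf_algebra (C : braided_category) := HopfAlgebra {
  hopf_alg :> algebra C;
  comul : hopf_alg ~> hopf_alg ⊗ hopf_alg;
  counit : hopf_alg ~> \I;
  antipode : hopf_alg ~> hopf_alg;
  comulA : assoc hopf_alg hopf_alg hopf_alg ∘ (comul ⊠ \id hopf_alg) ∘ comul
    = (\id hopf_alg ⊠ comul) ∘ comul;
  counitl : lunit hopf_alg ∘ (counit ⊠ \id hopf_alg) ∘ comul = \id hopf_alg;
  counitr : runit hopf_alg ∘ (\id hopf_alg ⊠ counit) ∘ comul = \id hopf_alg;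
  comul_mul : comul ∘ mul hopf_alg
    = (mul hopf_alg ⊠ mul hopf_alg)
      ∘ interchange hopf_alg hopf_alg hopf_alg hopf_alg ∘ (comul ⊠ comul);
  comul_one : comul ∘ one hopf_alg
    = (one hopf_alg ⊠ one hopf_alg) ∘ lunitV \I;
  counit_mul : counit ∘ mul hopf_alg = lunit \I ∘ (counit ⊠ counit);
  counit_one : counit ∘ one hopf_alg = \id \I;
  antipodel : mul hopf_alg ∘ (antipode ⊠ \id hopf_alg) ∘ comul
    = one hopf_alg ∘ counit;
  antipoder : mul hopf_alg ∘ (\id hopf_alg ⊠ antipode) ∘ comul
    = one hopf_alg ∘ counit
}.

Arguments comul {C} h.
Arguments counit {C} h.
Arguments antipode {C} h.

(** * Comodule algebras and Galois extensions *)

Section ComoduleAlgebras.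
Variables (C : braided_category) (H : hopf_algebra C).

Definition is_comodule (M : C) (psi : M ~> M ⊗ H) : Prop :=
  assoc M H H ∘ (psi ⊠ \id H) ∘ psi = (\id M ⊠ comul H) ∘ psi /\
  runit M ∘ (\id M ⊠ counit H) ∘ psi = \id M.

Definition is_comodule_algebra (A : algebra C) (psi : A ~> A ⊗ H) : Prop :=
  is_comodule psi /\
  psi ∘ mul A = (mul A ⊠ mul H) ∘ interchange A H A H ∘ (psi ⊠ psi) /\
  psi ∘ one A = (one A ⊠ one H) ∘ lunitV \I.

Definition is_comodule_morphism (M N : C) (psiM : M ~> M ⊗ H)
    (psiN : N ~> N ⊗ H) (f : M ~> N) : Prop :=
  psiN ∘ f = (f ⊠ \id H) ∘ psiM.

Definition is_module_morphism (B : algebra C) (M N : C) (actM : B ⊗ M ~> M)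
    (actN : B ⊗ N ~> N) (f : M ~> N) : Prop :=
  f ∘ actM = actN ∘ (\id B ⊠ f).

Definition is_coinvariants (A B : algebra C) (psi : A ~> A ⊗ H)
    (p : B ~> A) : Prop :=
  is_algebra_morphism p /\
  is_equaliser psi ((\id A ⊠ one H) ∘ runitV A) p.

Definition is_tensor_over (A B : algebra C) (p : B ~> A)
    (Q : C) (q : A ⊗ A ~> Q) : Prop :=
  is_coequaliser
    ((mul A ⊠ \id A) ∘ ((\id A ⊠ p) ⊠ \id A))
    ((\id A ⊠ mul A) ∘ assoc A A A ∘ ((\id A ⊠ p) ⊠ \id A)) q.

Definition can' (A : algebra C) (psi : A ~> A ⊗ H) : A ⊗ A ~> A ⊗ H :=
  (mul A ⊠ \id H) ∘ assocV A A H ∘ (\id A ⊠ psi).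

Definition is_galois (A : algebra C) (psi : A ~> A ⊗ H)
    (Q : C) (q : A ⊗ A ~> Q) : Prop :=
  exists can : Q ~> A ⊗ H, is_iso can /\ can ∘ q = can' psi.

Definition restricted_action (A B : algebra C) (p : B ~> A) : B ⊗ A ~> A :=
  mul A ∘ (p ⊠ \id A).

Definition free_action (B : algebra C) : B ⊗ (B ⊗ H) ~> B ⊗ H :=
  (mul B ⊠ \id H) ∘ assocV B B H.

Definition cofree_coaction (B : C) : B ⊗ H ~> (B ⊗ H) ⊗ H :=
  assocV B H H ∘ (\id B ⊠ comul H).

(* [A ≅ B ⊗ H] by a single morphism that is both linear and colinear. *)
Definition has_normal_basis (A B : algebra C) (psi : A ~> A ⊗ H)
    (p : B ~> A) : Prop :=
  exists theta : A ~> B ⊗ H,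
    is_iso theta /\
    is_module_morphism (restricted_action p) (free_action B) theta /\
    is_comodule_morphism psi (cofree_coaction B) theta.

End ComoduleAlgebras.

(** * Crossed products *)

Section CrossedProducts.
Variables (C : braided_category) (H : hopf_algebra C) (B : algebra C).

Definition is_weak_action (alpha : H ⊗ B ~> B) : Prop :=
  alpha ∘ (\id H ⊠ mul B)
    = mul B ∘ (alpha ⊠ alpha) ∘ interchange H H B B
      ∘ (comul H ⊠ \id (B ⊗ B)) /\
  alpha ∘ (\id H ⊠ one B) ∘ runitV H = one B ∘ counit H.

(* [(H ⊗ C ⊗ H)(Δ_H ⊗ Δ_H)], the comultiplication of [H ⊗ H]. *)
Definition comul2 : H ⊗ H ~> (H ⊗ H) ⊗ (H ⊗ H) :=
  interchange H H H H ∘ (comul H ⊠ comul H).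

Definition counit2 : H ⊗ H ~> \I := lunit \I ∘ (counit H ⊠ counit H).

Definition is_cocycle (alpha : H ⊗ B ~> B) (sigma : H ⊗ H ~> B) : Prop :=
  mul B ∘ (alpha ⊠ sigma) ∘ interchange H H B H
      ∘ (\id (H ⊗ H) ⊠ (sigma ⊠ mul H)) ∘ (comul H ⊠ comul2) ∘ assoc H H H
    = mul B ∘ (\id B ⊠ sigma) ∘ assoc B H H
      ∘ ((sigma ⊠ mul H) ⊠ \id H) ∘ (comul2 ⊠ \id H) /\
  sigma ∘ (\id H ⊠ one H) ∘ runitV H = one B ∘ counit H /\
  sigma ∘ (one H ⊠ \id H) ∘ lunitV H = one B ∘ counit H.

Definition is_convolution_invertible (sigma : H ⊗ H ~> B) : Prop :=
  exists omega : H ⊗ H ~> B,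
    mul B ∘ (sigma ⊠ omega) ∘ comul2 = one B ∘ counit2 /\
    mul B ∘ (omega ⊠ sigma) ∘ comul2 = one B ∘ counit2.

(* In element notation,
   [(b # h)(b' # h') = b (h1 . b') sigma(h2, h'1) # h3 h'2]. *)
Definition crossed_mul (alpha : H ⊗ B ~> B) (sigma : H ⊗ H ~> B) :
    (B ⊗ H) ⊗ (B ⊗ H) ~> B ⊗ H :=
  (mul B ⊠ \id H) ∘ assocV B B H
  ∘ (mul B ⊠ (sigma ⊠ mul H))
  ∘ assocV B B ((H ⊗ H) ⊗ (H ⊗ H))
  ∘ (\id B ⊠ (alpha ⊠ comul2))
  ∘ (\id B ⊠ interchange H H B H)
  ∘ (\id B ⊠ (comul H ⊠ \id (B ⊗ H)))
  ∘ assoc B H (B ⊗ H).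

Definition crossed_one : \I ~> B ⊗ H := (one B ⊠ one H) ∘ lunitV \I.

Definition crossed_product (alpha : H ⊗ B ~> B) (sigma : H ⊗ H ~> B)
    (assoc_unital : is_algebra (crossed_mul alpha sigma) crossed_one) :
    algebra C :=
  Algebra assoc_unital.

End CrossedProducts.

(* Main.v *)
Require Import Defs.

(** Both sides of the equivalence are compared with a third description of the
extension of [B] by [H], the cleft extensions [is_cleft]: an algebra morphism
[p : B ~> A] and a morphism [gam : H ~> A] preserving the unit, such that
[J : b ⊗ h |-> p(b) gam(h)] is an isomorphism from [B ⊗ H] to [A], together
with [alpha] and [sigma] satisfying, in element notation,

  [gam(h) p(b) = p(alpha(h1, b)) gam(h2)],
  [gam(h) gam(k) = p(sigma(h1, k1)) gam(h2 k2)].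

Crossed products ([crossed_productP]). The two relations say exactly that [J]
transports the multiplication of [A] to the crossed product multiplication, so
that the latter is associative and unital. Moreover [(B ⊗ counit) J^-1] sends
[gam(h) p(b)] to [alpha(h, b)] and [gam(h) gam(k)] to [sigma(h, k)]; the axioms
of weak actions and cocycles are the images under this left [B]-linear map of
instances of associativity in [A]. Conversely [b |-> b # 1] and [h |-> 1 # h]
make a crossed product cleft.

Galois extensions ([cleft_galois], [galois_cleft]). For a coalgebra [D] and
[s : D ~> B] let [twist s] be the endomorphism [b ⊗ d |-> b s(d1) ⊗ d2] of
[B ⊗ D]. It is [B]-linear and [D]-colinear, hence so is its inverse when it has
one, and [s] is convolution invertible if and only if [twist s] is an
isomorphism ([conv_invertibleP]). Instead of computing the inverse of [gam]
from the antipode and the inverse of [sigma], one compares twists: the identity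
[b gam(k) gam(h1) ⊗ h2 = b sigma(k1, h1) gam(k2 h2) ⊗ h3] means that, up to the
isomorphism [J ⊗ H], [twist gam] is [twist sigma] followed by [B ⊗ twist id],
and the identity of [H] is convolution invertible with inverse the antipode. So
[twist gam] is an isomorphism if and only if [sigma] is convolution invertible
([twist_invertible]).

Finally [twist gam] is the restriction of [can'] along [A ⊗ gam]. When it is
invertible, [(A ⊗ gam) (twist gam)^-1] is a section of [can'], and this section
exhibits [can'] itself as the coequaliser defining the tensor product of [A]
with [A] over [B]. When [A] has a normal basis, [A ⊗ gam] followed by [q] is an
isomorphism from [A ⊗ H] to that tensor product, so the Galois condition makes
[twist gam] invertible. In this direction [alpha] and [sigma] are read off from
the decomposition [a = p(base_part(a0)) gam(a1)], once the normal basis has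
been corrected to preserve the unit.

The computations take place in a braided category that need not be strict. Each
morphism [f] is replaced by the family of the [f ⊠ \id z], conjugated to act on
tensor products nested to the right ([lift]). On this form associativity and
unit constraints become identities, a composite is a list of operations each
acting on some consecutive strands, and the one remaining structural law is the
interchange of operations acting on disjoint strands ([lift_natural]). The
tactic [rw] rewrites with an equation of morphisms modulo this law. *)

Set Implicit Arguments.
Unset Strict Implicit.
Unset Printing Implicit Defensive.

(** * Whiskering *)

Local Notation "x ▷ f" := (\id x ⊠ f) (at level 40, f at level 39, left associativity) : cat_scope.

Section Whisker.
Variable C : monoidal_category.
Implicit Types x y z : C.

Lemma whisk_comp x y z t (g : z ~> t) (f : y ~> z) : x ▷ (g ∘ f) = (x ▷ g) ∘ (x ▷ f).
Proof. rewrite <- tensm_comp, comp1m; reflexivity. Qed.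

Lemma whisk_id x y : x ▷ (\id y) = \id (x ⊗ y).
Proof. apply tensm_id. Qed.

Lemma comp_rwhisk x y z t (g : y ~> z) (f : x ~> y) :
  (g ∘ f) ⊠ \id t = (g ⊠ \id t) ∘ (f ⊠ \id t).
Proof. rewrite <- tensm_comp, comp1m; reflexivity. Qed.

Lemma exchange x y x' y' (f : x ~> y) (g : x' ~> y') :
  f ⊠ g = (f ⊠ \id y') ∘ (x ▷ g).
Proof. rewrite <- tensm_comp, comp1m, compm1; reflexivity. Qed.

Lemma exchange' x y x' y' (f : x ~> y) (g : x' ~> y') :
  (f ⊠ \id y') ∘ (x ▷ g) = (y ▷ g) ∘ (f ⊠ \id x').
Proof. rewrite <- !tensm_comp, !comp1m, !compm1; reflexivity. Qed.

(** Putting an arbitrary morphism behind both sides turns each composite into a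
chain that ends with a variable, so that a rule can be applied anywhere in it. *)
Lemma ext_post (c : category) (x y : c) (f g : x ~> y) :
  (forall w (k : w ~> x), f ∘ k = g ∘ k) -> f = g.
Proof. intros h. rewrite <- (compm1 f), <- (compm1 g). apply h. Qed.

Lemma lwhisk_unit_inj x y (f g : x ~> y) : \I ▷ f = \I ▷ g -> f = g.
Proof.
  intros h.
  rewrite <- (compm1 f), <- (compm1 g), <- (lunitVK x), !compA, <- !lunit_natural, h.
  reflexivity.
Qed.

Lemma rwhisk_unit_inj x y (f g : x ~> y) : f ⊠ \id \I = g ⊠ \id \I -> f = g.
Proof.
  intros h.
  rewrite <- (compm1 f), <- (compm1 g), <- (runitVK x), !compA, <- !runit_natural, h.
  reflexivity.
Qed.

Lemma epi_of_section (c : category) (x y z : c) (f g : y ~> z) (e : x ~> y) (s : y ~> x) :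
  e ∘ s = \id y -> f ∘ e = g ∘ e -> f = g.
Proof. intros h k. rewrite <- (compm1 f), <- (compm1 g), <- h, !compA, k. reflexivity. Qed.

Lemma mono_of_retraction (c : category) (x y z : c) (f g : x ~> y) (m : y ~> z) (r : z ~> y) :
  r ∘ m = \id y -> m ∘ f = m ∘ g -> f = g.
Proof. intros h k. rewrite <- (comp1m f), <- (comp1m g), <- h, <- !compA, k. reflexivity. Qed.

(** Kelly's coherence law: after whiskering by the unit object it follows from
the pentagon with two unit objects, all of whose other sides are instances of
the triangle or of naturality. *)
Lemma lunit_tens x y : lunit (x ⊗ y) ∘ assoc \I x y = lunit x ⊠ \id y.
Proof.
  apply lwhisk_unit_inj. rewrite whisk_comp.
  assert (s : (assoc \I (\I ⊗ x) y ∘ (assoc \I \I x ⊠ \id y))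
    ∘ ((assocV \I \I x ⊠ \id y) ∘ assocV \I (\I ⊗ x) y) = \id _).
  { rewrite <- compA, (compA (_ ⊠ _) (_ ⊠ _)), <- comp_rwhisk, assocVK, tensm_id, comp1m.
    apply assocVK. }
  apply (epi_of_section s).
  rewrite <- compA, <- pentagon, compA, triangle, <- tensm_id, <- assoc_natural.
  rewrite (compA (_ ⊠ _) (assoc _ _ _)), <- assoc_natural, <- compA, <- comp_rwhisk, triangle.
  reflexivity.
Qed.

End Whisker.

(** * Right-nested tensor products *)

Section Strict.
Variable C : monoidal_category.

Inductive tree := leaf (x : C) | unit | node (s t : tree).

Fixpoint ev (t : tree) : C :=
  match t with leaf x => x | unit => \I | node s t => ev s ⊗ ev t end.

(** The tensor product of the leaves of [t] nested to the right, ending in [z].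
As [z] is a parameter, [flat (node s t) z] is by definition the composite
[flat s (flat t z)], which is what makes all associativity constraints vanish. *)
Fixpoint flat (t : tree) (z : C) : C :=
  match t with leaf x => x ⊗ z | unit => z | node s t => flat s (flat t z) end.

Fixpoint flat_map (t : tree) (z z' : C) (g : z ~> z') {struct t} : flat t z ~> flat t z' :=
  match t with
  | leaf x => x ▷ g
  | unit => g
  | node s t => flat_map s (flat_map t g)
  end.

Fixpoint flatten (t : tree) (z : C) : ev t ⊗ z ~> flat t z :=
  match t with
  | leaf x => \id (x ⊗ z)
  | unit => lunit z
  | node s t => flatten s (flat t z) ∘ (ev s ▷ flatten t z) ∘ assoc (ev s) (ev t) z
  end.

Fixpoint unflatten (t : tree) (z : C) : flat t z ~> ev t ⊗ z :=
  match t with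
  | leaf x => \id (x ⊗ z)
  | unit => lunitV z
  | node s t => assocV (ev s) (ev t) z ∘ (ev s ▷ unflatten t z) ∘ unflatten s (flat t z)
  end.

Lemma flattenK t z : unflatten t z ∘ flatten t z = \id _.
Proof.
  revert z; induction t as [x| |s IHs t IHt]; intros z; cbn [flatten unflatten].
  - apply comp1m.
  - apply lunitK.
  - rewrite <- !compA, (compA (unflatten s _)), IHs, comp1m.
    rewrite (compA (_ ▷ _) (_ ▷ _)), <- whisk_comp, IHt, whisk_id, comp1m. apply assocK.
Qed.

Lemma unflattenK t z : flatten t z ∘ unflatten t z = \id _.
Proof.
  revert z; induction t as [x| |s IHs t IHt]; intros z; cbn [flatten unflatten].
  - apply comp1m.
  - apply lunitVK.
  - rewrite <- !compA, (compA (assoc _ _ _)), assocVK, comp1m.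
    rewrite (compA (_ ▷ _) (_ ▷ _)), <- whisk_comp, IHt, whisk_id, comp1m. apply IHs.
Qed.

Lemma flatten_natural t z z' (g : z ~> z') :
  flatten t z' ∘ (ev t ▷ g) = flat_map t g ∘ flatten t z.
Proof.
  revert z z' g; induction t as [x| |s IHs t IHt]; intros z z' g; cbn [flatten flat_map ev].
  - rewrite comp1m, compm1; reflexivity.
  - apply lunit_natural.
  - rewrite <- !compA, <- tensm_id, assoc_natural, (compA (_ ▷ flatten _ _)), <- whisk_comp, IHt,
      whisk_comp, <- compA, (compA (flatten s _)), IHs, <- !compA.
    reflexivity.
Qed.

Lemma flat_map_comp t x y z (g : y ~> z) (f : x ~> y) :
  flat_map t (g ∘ f) = flat_map t g ∘ flat_map t f.
Proof.
  revert x y z g f; induction t as [x| |s IHs t IHt]; intros; cbn [flat_map].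
  - apply whisk_comp.
  - reflexivity.
  - rewrite IHt. apply IHs.
Qed.

Lemma flat_map_id t x : flat_map t (\id x) = \id _.
Proof.
  revert x; induction t as [x| |s IHs t IHt]; intros; cbn [flat_map].
  - apply whisk_id.
  - reflexivity.
  - rewrite IHt. apply IHs.
Qed.

(** The morphism [f] acting on the leftmost strands of a right-nested tensor
product. *)
Definition lift (s t : tree) (f : ev s ~> ev t) (z : C) : flat s z ~> flat t z :=
  flatten t z ∘ (f ⊠ \id z) ∘ unflatten s z.

Lemma lift_flatten s t f z : @lift s t f z ∘ flatten s z = flatten t z ∘ (f ⊠ \id z).
Proof. unfold lift. rewrite <- !compA, flattenK, compm1. reflexivity. Qed.

Lemma lift_unique s t (f : ev s ~> ev t) z (g : flat s z ~> flat t z) :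
  g ∘ flatten s z = flatten t z ∘ (f ⊠ \id z) -> lift f z = g.
Proof.
  rewrite <- lift_flatten. intros h. apply (epi_of_section (unflattenK s z)).
  symmetry. exact h.
Qed.

Lemma lift_inj s t (f g : ev s ~> ev t) : (forall z, lift f z = lift g z) -> f = g.
Proof.
  intros h. apply rwhisk_unit_inj. apply (mono_of_retraction (flattenK t \I)).
  rewrite <- !lift_flatten, h. reflexivity.
Qed.

(** Interchange: an operation [g] on the strands to the right of those of [f] can
be executed before or after [f]. *)
Lemma lift_natural s t (f : ev s ~> ev t) z z' (g : z ~> z') :
  lift f z' ∘ flat_map s g = flat_map t g ∘ lift f z.
Proof.
  apply (epi_of_section (unflattenK s z)).
  rewrite <- !compA, <- flatten_natural, lift_flatten, (compA (lift f z')), lift_flatten,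
    <- compA, exchange',
    compA, flatten_natural, compA.
  reflexivity.
Qed.

Lemma lift_comp s r t (g : ev r ~> ev t) (f : ev s ~> ev r) z :
  @lift s t (g ∘ f) z = @lift r t g z ∘ @lift s r f z.
Proof.
  apply lift_unique. rewrite comp_rwhisk, <- compA, lift_flatten, !compA, lift_flatten. reflexivity.
Qed.

Lemma lift_id s z : @lift s s (\id (ev s)) z = \id _.
Proof. apply lift_unique. rewrite tensm_id, comp1m, compm1. reflexivity. Qed.

Lemma lift_tens s1 s2 t1 t2 (f : ev s1 ~> ev t1) (g : ev s2 ~> ev t2) z :
  @lift (node s1 s2) (node t1 t2) (f ⊠ g) z = lift f (flat t2 z) ∘ flat_map s1 (lift g z).
Proof.
  apply lift_unique; cbn [flatten ev flat].
  assert (h : (ev t1 ▷ flatten t2 z) ∘ (f ⊠ (g ⊠ \id z))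
    = (f ⊠ \id _) ∘ (ev s1 ▷ lift g z) ∘ (ev s1 ▷ flatten s2 z)).
  { rewrite <- whisk_comp, lift_flatten, <- !tensm_comp, !comp1m, compm1. reflexivity. }
  rewrite <- !compA, assoc_natural, (compA (_ ▷ flatten t2 z)), h, (compA (flatten t1 _)), compA.
  rewrite (compA (flatten t1 _)), <- lift_flatten, <- !compA, (compA (flat_map _ _)),
    <- flatten_natural, <- !compA.
  reflexivity.
Qed.

(** The pentagon says that both ways of flattening a threefold product agree up
to the associativity constraint. *)
Lemma lift_assoc r s t z : @lift (node (node r s) t) (node r (node s t)) (assoc _ _ _) z = \id _.
Proof.
  apply lift_unique; cbn [flatten ev flat].
  rewrite comp1m, <- !compA, !whisk_comp, <- !compA, <- pentagon.
  rewrite (compA (assoc _ _ _) (_ ▷ _)), <- tensm_id, assoc_natural, <- compA. reflexivity.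
Qed.

Lemma lift_inverse s t (f : ev s ~> ev t) (g : ev t ~> ev s) z :
  f ∘ g = \id _ -> lift f z ∘ lift g z = \id _.
Proof. intros h. rewrite <- lift_comp, h. apply lift_id. Qed.

Lemma lift_assocV r s t z : @lift (node r (node s t)) (node (node r s) t) (assocV _ _ _) z = \id _.
Proof. 
  rewrite <- (@lift_inverse (node (node r s) t) (node r (node s t)) _ _ z (assocVK _ _ _)).
  rewrite lift_assoc, comp1m. reflexivity.
Qed.

Lemma lift_lunit t z : @lift (node unit t) t (lunit _) z = \id _.
Proof.
  apply lift_unique; cbn [flatten ev flat].
  rewrite comp1m, <- lunit_tens, !compA, lunit_natural. reflexivity.
Qed.

Lemma lift_lunitV t z : @lift t (node unit t) (lunitV _) z = \id _.
Proof.
  rewrite <- (@lift_inverse (node unit t) t _ _ z (lunitVK _)), lift_lunit, comp1m. reflexivity.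
Qed.

Lemma lift_runit t z : @lift (node t unit) t (runit _) z = \id _.
Proof.
  apply lift_unique; cbn [flatten ev flat].
  rewrite comp1m, <- triangle. reflexivity.
Qed.

Lemma lift_runitV t z : @lift t (node t unit) (runitV _) z = \id _.
Proof.
  rewrite <- (@lift_inverse (node t unit) t _ _ z (runitVK _)), lift_runit, comp1m. reflexivity.
Qed.

End Strict.

Arguments unit {C}.
Arguments lift {C s t} f z : simpl never.

(** * Translating equations into right-nested form *)

Section Eq.
Variable C : monoidal_category.
Implicit Types r s t : tree C.

Lemma lift_comp_eq s r t (g : ev r ~> ev t) (f : ev s ~> ev r) z g' f' :
  lift g z = g' -> lift f z = f' -> @lift C s t (g ∘ f) z = g' ∘ f'.
Proof. intros <- <-. apply lift_comp. Qed.

Lemma lift_tens_eq s1 s2 t1 t2 (f : ev s1 ~> ev t1) (g : ev s2 ~> ev t2) z f' g' :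
  lift f (flat t2 z) = f' -> lift g z = g' ->
  @lift C (node s1 s2) (node t1 t2) (f ⊠ g) z = f' ∘ flat_map s1 g'.
Proof. intros <- <-. apply lift_tens. Qed.

Lemma lift_cong s t (f g : ev s ~> ev t) z f' g' :
  f = g -> lift f z = f' -> lift g z = g' -> f' = g'.
Proof. intros -> <- <-. reflexivity. Qed.

End Eq.

(** Objects of the form [ev s] are recognised, so that the translation also
applies to equations between variable trees, such as the hexagons. *)
Ltac reify_ob x :=
  lazymatch x with
  | tens ?a ?b => let s := reify_ob a in let t := reify_ob b in constr:(node s t)
  | @unit_ob ?C => constr:(@unit C)
  | @ev _ ?s => s
  | ?a => constr:(leaf a)
  end.

(** A proof of [lift f z = g], where [g] is the composite of the lifts of the
elementary constituents of [f]; compound morphisms such as [interchange] or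
[comul2] are unfolded on the way. *)
Ltac lift_eq s t f z :=
  lazymatch f with
  | @comp _ _ ?y _ ?g ?f =>
      let r := reify_ob y in
      let p := lift_eq r t g z in
      let q := lift_eq s r f z in
      constr:(lift_comp_eq p q)
  | @tensm _ _ _ _ _ ?f ?g =>
      lazymatch s with
      | node ?s1 ?s2 =>
        lazymatch t with
        | node ?t1 ?t2 =>
          let z' := eval cbn [flat] in (flat t2 z) in
          let p := lift_eq s1 t1 f z' in
          let q := lift_eq s2 t2 g z in
          constr:(@lift_tens_eq _ s1 s2 t1 t2 _ _ _ _ _ p q)
        end
      end
  | @idm _ _ => constr:(@lift_id _ s z)
  | @assoc _ ?a ?b ?c =>
      let r := reify_ob a in let s := reify_ob b in let t := reify_ob c in
      constr:(@lift_assoc _ r s t z)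
  | @assocV _ ?a ?b ?c =>
      let r := reify_ob a in let s := reify_ob b in let t := reify_ob c in
      constr:(@lift_assocV _ r s t z)
  | @lunit _ ?a => let r := reify_ob a in constr:(@lift_lunit _ r z)
  | @lunitV _ ?a => let r := reify_ob a in constr:(@lift_lunitV _ r z)
  | @runit _ ?a => let r := reify_ob a in constr:(@lift_runit _ r z)
  | @runitV _ ?a => let r := reify_ob a in constr:(@lift_runitV _ r z)
  | @interchange _ _ _ _ _ =>
      let f := eval unfold interchange in f in lift_eq s t f z
  | @comul2 _ _ => let f := eval unfold comul2 in f in lift_eq s t f z
  | @counit2 _ _ => let f := eval unfold counit2 in f in lift_eq s t f z
  | @cofree_coaction _ _ _ => let f := eval unfold cofree_coaction in f in lift_eq s t f z
  | @free_action _ _ _ => let f := eval unfold free_action in f in lift_eq s t f z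
  | @restricted_action _ _ _ _ => let f := eval unfold restricted_action in f in lift_eq s t f z
  | @can' _ _ _ _ => let f := eval unfold can' in f in lift_eq s t f z
  | _ => constr:(eq_refl (@lift _ s t f z))
  end.

(** Normal form: a composite nested to the right of operations [x ▷ ... ▷ lift f z]
with [f] elementary. *)
Ltac chain_in E :=
  cbn [ev flat flat_map] in E;
  rewrite ?flat_map_id, ?flat_map_comp, ?whisk_id, ?comp1m, ?compm1, ?whisk_comp, <- ?compA in E.

Ltac strict_of E z :=
  lazymatch type of E with
  | @eq (@hom _ ?x ?y) ?f ?g =>
    let s := reify_ob x in let t := reify_ob y in
    let p := lift_eq s t f z in
    let q := lift_eq s t g z in
    constr:(@lift_cong _ s t f g z _ _ E p q)
  end.

(** * The braiding on right-nested tensor products *)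

Section Braiding.
Variable C : braided_category.
Implicit Types r s t : tree C.

Notation β s t z := (@lift C (node s t) (node t s) (braid (ev s) (ev t)) z).
Notation βV s t z := (@lift C (node t s) (node s t) (braidV (ev s) (ev t)) z).

Lemma lift_braidV s t z : βV s t z ∘ β s t z = \id _.
Proof. exact (@lift_inverse C (node t s) (node s t) _ _ z (@braidK C _ _)). Qed.

Lemma lift_braid_natural s s' t t' (f : ev s ~> ev s') (g : ev t ~> ev t') z :
  β s' t' z ∘ lift f (flat t' z) ∘ flat_map s (lift g z)
  = lift g (flat s' z) ∘ flat_map t (lift f z) ∘ β s t z.
Proof.
  rewrite (compA (lift g _)), <- !lift_tens.
  etransitivity; [symmetry; exact (@lift_comp C (node s t) (node s' t') (node t' s') _ (f ⊠ g) z)|].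
  etransitivity; [|exact (@lift_comp C (node s t) (node t s) (node t' s') (g ⊠ f) _ z)].
  exact (f_equal (fun f => @lift C (node s t) (node t' s') f z) (braid_natural f g)).
Qed.

Lemma lift_braid_node_r r s t z :
  β r (node s t) z = flat_map s (β r t z) ∘ β r s (flat t z).
Proof.
  assert (h := hexagon1 (ev r) (ev s) (ev t)).
  let k := strict_of h z in assert (h' := k).
  chain_in h'. exact h'.
Qed.

Lemma lift_braid_node_l r s t z :
  β (node r s) t z = β r t (flat s z) ∘ flat_map r (β s t z).
Proof.
  assert (h := hexagon2 (ev r) (ev s) (ev t)).
  let k := strict_of h z in assert (h' := k).
  chain_in h'. exact h'.
Qed.

(** By the hexagon and naturality with respect to [lunit \I], the braiding with
the unit object is idempotent; being invertible, it is the identity. *)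
Lemma lift_braid_unit_l t z : β unit t z = \id _.
Proof.
  assert (h := lift_braid_natural (lunit \I : ev (node unit unit) ~> ev unit) (\id (ev t)) z).
  rewrite lift_braid_node_l in h.
  rewrite !(lift_lunit unit), !lift_id in h. cbn [flat flat_map ev] in h.
  rewrite !flat_map_id, !comp1m, !compm1 in h.
  apply (mono_of_retraction (lift_braidV unit t z)). cbn [flat flat_map ev] in h |- *.
  rewrite compm1. symmetry. exact h.
Qed.

Lemma lift_braid_unit_r t z : β t unit z = \id _.
Proof.
  assert (h := lift_braid_natural (\id (ev t)) (lunit \I : ev (node unit unit) ~> ev unit) z).
  rewrite lift_braid_node_r in h.
  rewrite !(lift_lunit unit), !lift_id in h. cbn [flat flat_map ev] in h.
  rewrite !flat_map_id, !comp1m, !compm1 in h.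
  apply (mono_of_retraction (lift_braidV t unit z)). cbn [flat flat_map ev] in h |- *.
  rewrite compm1. symmetry. exact h.
Qed.

End Braiding.

Section Cross.
Variable C : braided_category.
Implicit Types r s t : tree C.
Notation β s t z := (@lift C (node s t) (node t s) (braid (ev s) (ev t)) z).

(** A single strand [y] moving to the left, respectively to the right, through a
right-nested product, one elementary braiding at a time. *)
Fixpoint cross s (y z : C) : flat s (y ⊗ z) ~> y ⊗ flat s z :=
  match s with
  | leaf x => @lift C (node (leaf x) (leaf y)) (node (leaf y) (leaf x)) (braid x y) z
  | unit => \id _
  | node s t => cross s y (flat t z) ∘ flat_map s (cross t y z)
  end.

Fixpoint crossr (y : C) t (z : C) : y ⊗ flat t z ~> flat t (y ⊗ z) :=
  match t with
  | leaf x => @lift C (node (leaf y) (leaf x)) (node (leaf x) (leaf y)) (braid y x) z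
  | unit => \id _
  | node s t => flat_map s (crossr y t z) ∘ crossr y s (flat t z)
  end.

Lemma crossE s y z : β s (leaf y) z = cross s y z.
Proof.
  revert z; induction s as [x| |s IHs t IHt]; intros z; cbn [cross].
  - reflexivity.
  - apply lift_braid_unit_l.
  - rewrite lift_braid_node_l, IHt, IHs. reflexivity.
Qed.

Lemma crossrE t y z : β (leaf y) t z = crossr y t z.
Proof.
  revert z; induction t as [x| |s IHs t IHt]; intros z; cbn [crossr].
  - reflexivity.
  - apply lift_braid_unit_r.
  - rewrite lift_braid_node_r, IHt, IHs. reflexivity.
Qed.

Lemma cross_natural s t (f : ev s ~> ev t) y z :
  cross t y z ∘ lift f (y ⊗ z) = (y ▷ lift f z) ∘ cross s y z.
Proof.
  rewrite <- !crossE. assert (h := lift_braid_natural f (\id y : ev (leaf y) ~> ev (leaf y)) z).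
  rewrite !(lift_id (leaf y)) in h. cbn [flat flat_map ev] in *.
  rewrite ?flat_map_id, ?compm1, ?comp1m in h.
  exact h.
Qed.

Lemma crossr_natural s t (f : ev s ~> ev t) y z :
  crossr y t z ∘ (y ▷ lift f z) = lift f (y ⊗ z) ∘ crossr y s z.
Proof.
  rewrite <- !crossrE. assert (h := lift_braid_natural (\id y : ev (leaf y) ~> ev (leaf y)) f z).
  rewrite !(lift_id (leaf y)) in h. cbn [flat flat_map ev] in *.
  rewrite ?flat_map_id, ?compm1, ?comp1m in h.
  exact h.
Qed.

(* The next lemmas are the steps by which the tactics below whisker and
   precompose an equation without searching for redexes. *)
Lemma push_comp (x y z t : C) (a : z ~> t) (m : y ~> z) m' :
  x ▷ m = m' -> x ▷ (a ∘ m) = (x ▷ a) ∘ m'.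
Proof. intros <-. apply whisk_comp. Qed.

Lemma suffix_comp (w y z t : C) (a : z ~> t) (m : y ~> z) (k : w ~> y) k' :
  m ∘ k = k' -> (a ∘ m) ∘ k = a ∘ k'.
Proof. intros <-. symmetry. apply compA. Qed.

Lemma whisk_glue (x y z : C) (f g : y ~> z) f' g' :
  f = g -> x ▷ f = f' -> x ▷ g = g' -> f' = g'.
Proof. intros -> <- <-. reflexivity. Qed.

Lemma suffix_glue (w y z : C) (f g : y ~> z) (k : w ~> y) f' g' :
  f = g -> f ∘ k = f' -> g ∘ k = g' -> f' = g'.
Proof. intros -> <- <-. reflexivity. Qed.

Lemma swap_whisk (x y z t u : C) (a : z ~> t) (b : y ~> z) (b' : u ~> t) (a' : y ~> u) :
  a ∘ b = b' ∘ a' -> (x ▷ a) ∘ (x ▷ b) = (x ▷ b') ∘ (x ▷ a').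
Proof. intros h. rewrite <- !whisk_comp, h. reflexivity. Qed.

Lemma swap_post (w y z t u : C) (a : z ~> t) (b : y ~> z) (b' : u ~> t) (a' : y ~> u) :
  a ∘ b = b' ∘ a' -> forall k : w ~> y, a ∘ b ∘ k = b' ∘ a' ∘ k.
Proof. intros h k. rewrite !compA, h. reflexivity. Qed.

End Cross.

(** * Rewriting modulo interchange *)

Ltac simp_in E := cbn [cross crossr] in E; chain_in E.

Ltac simp :=
  cbn [ev flat flat_map cross crossr];
  rewrite ?flat_map_id, ?flat_map_comp, ?whisk_comp, ?whisk_id, ?comp1m, ?compm1, <- ?compA.

(** The [g] such that the given morphism is [flat_map t g]. *)
Ltac strip_tree t g :=
  lazymatch t with
  | leaf _ => lazymatch g with @tensm _ _ _ _ _ (@idm _ _) ?g' => g' end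
  | unit => g
  | node ?s ?t => let g' := strip_tree s g in strip_tree t g'
  end.

(** Proofs that [p ∘ q] can be executed in the other order, where the strands of
[q] lie to the right of those of [p] ([swapL]) or to their left ([swapR]). *)
Ltac swapL p q :=
  lazymatch p with
  | @tensm _ _ _ _ _ (@idm _ ?x) ?p' =>
    lazymatch q with
    | @tensm _ _ _ _ _ (@idm _ _) ?q' => let e := swapL p' q' in constr:(swap_whisk x e)
    end
  | @lift _ ?s ?t ?f _ => let g := strip_tree s q in constr:(@lift_natural _ s t f _ _ g)
  end.

Ltac swapR p q :=
  lazymatch q with
  | @tensm _ _ _ _ _ (@idm _ ?x) ?q' =>
    lazymatch p with
    | @tensm _ _ _ _ _ (@idm _ _) ?p' => let e := swapR p' q' in constr:(swap_whisk x e)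
    end
  | @lift _ ?s ?t ?f _ => let g := strip_tree t p in constr:(eq_sym (@lift_natural _ s t f _ _ g))
  end.

Ltac rewrite_swap e k :=
  let e := constr:(swap_post e k) in
  let T := type of e in
  let T := eval cbn [ev flat flat_map] in T in
  let h := fresh in
  assert (h : T) by exact e; rewrite h; clear h.

(** Two orders of execution: operations on the left come first ([nfL]), or
operations on the right do ([nfR]). On a diagram with a component that is a
nontrivial endomorphism of the unit object these loops can run forever, since
such a component can be moved around freely; the proofs below evaluate units
and counits before such a component appears. *)
Ltac nfL := repeat
  match goal with
  | |- context [@comp _ _ _ _ ?p (@comp _ _ _ _ ?q ?k)] =>
    let e := swapL p q in rewrite_swap e k
  end.

Ltac nfR := repeat
  match goal with
  | |- context [@comp _ _ _ _ ?p (@comp _ _ _ _ ?q ?k)] =>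
    let e := swapR p q in rewrite_swap e k
  end.

Ltac rewrite_in e H :=
  let T := type of e in
  let T := eval cbn [ev flat flat_map] in T in
  let h := fresh in
  assert (h : T) by exact e; rewrite h in H; clear h.

Ltac is_op q := lazymatch q with @comp _ _ _ _ _ _ => fail | _ => idtac end.

Ltac nf_in right_first H :=
  lazymatch right_first with
  | true => repeat
    match type of H with
    | context [@comp _ _ _ _ ?p (@comp _ _ _ _ ?q ?k)] =>
      let e := swapR p q in rewrite_in (swap_post e k) H
    | context [@comp _ _ _ _ ?p ?q] => is_op q; let e := swapR p q in rewrite_in e H
    end
  | false => repeat
    match type of H with
    | context [@comp _ _ _ _ ?p (@comp _ _ _ _ ?q ?k)] =>
      let e := swapL p q in rewrite_in (swap_post e k) H
    | context [@comp _ _ _ _ ?p ?q] => is_op q; let e := swapL p q in rewrite_in e H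
    end
  end.

(** As in the other tactics that return a proof of a family of equations, the
body goes under the binders of [E]; the final cast keeps the simplified type,
which would otherwise be recomputed from the proof. *)
Ltac nf_eq right_first E :=
  lazymatch type of E with
  | forall x : ?A, _ =>
    let y := fresh "x" in
    constr:(fun y : A => ltac:(let r := nf_eq right_first (E y) in exact r))
  | _ => constr:(ltac:(let H := fresh in pose proof E as H; nf_in right_first H;
      let T := type of H in exact (H : T)))
  end.

Ltac simp_eq E :=
  lazymatch type of E with
  | forall x : ?A, _ =>
    let y := fresh "x" in
    constr:(fun y : A => ltac:(let r := simp_eq (E y) in exact r))
  | _ => constr:(ltac:(let H := fresh in pose proof E as H; simp_in H;
      let T := type of H in exact (H : T)))
  end.

(** The translation of the equations [E], for every remaining tensor factor [z]. *)
Ltac strict E :=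
  lazymatch type of E with
  | forall x : ?A, _ =>
    let y := fresh "x" in constr:(fun y : A => ltac:(let r := strict (E y) in exact r))
  | @eq (@hom ?c _ _) _ _ =>
    let z := fresh "z" in constr:(fun z : ob c => ltac:(
      let k := strict_of E z in let H := fresh in pose proof k as H; simp_in H;
      let T := type of H in exact (H : T)))
  end.

Ltac push x m :=
  lazymatch m with
  | @comp _ _ _ _ ?a ?m' => let p := push x m' in constr:(push_comp a p)
  | @idm _ ?y => constr:(whisk_id x y)
  | _ => constr:(eq_refl (tensm (\id x) m))
  end.

Ltac suffix m k :=
  lazymatch m with
  | @comp _ _ _ _ ?a ?m' => let p := suffix m' k in constr:(suffix_comp a p)
  | @idm _ _ => constr:(comp1m k)
  | _ => constr:(eq_refl (m ∘ k))
  end.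

(** The chains of [E] acting to the right of [n] strands and followed by an
arbitrary rest [k]. *)
Ltac whisk n E :=
  lazymatch type of E with
  | forall x : ?A, _ =>
    let y := fresh "x" in constr:(fun y : A => ltac:(let r := whisk n (E y) in exact r))
  | @eq (@hom ?c ?a _) ?f ?g =>
    lazymatch n with
    | O =>
      let a := eval cbn [ev flat] in a in
      let w := fresh "w" in let k := fresh "k" in
      constr:(fun (w : ob c) (k : @hom c w a) => ltac:(
        let p := suffix f k in let q := suffix g k in exact (suffix_glue E p q)))
    | S ?n =>
      let y := fresh "x" in
      constr:(fun y : ob c => ltac:(
        let p := push y f in let q := push y g in
        let r := whisk n (whisk_glue E p q) in exact r))
    end
  end.

Ltac rw_whisk n E := idtac;
  let r := whisk n E in let H := fresh in
  pose proof r as H; cbn [ev flat flat_map cross crossr] in H; rewrite H; clear H.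
Ltac rwl_whisk n E := idtac;
  let r := whisk n E in let H := fresh in
  pose proof r as H; cbn [ev flat flat_map cross crossr] in H; rewrite <- H; clear H.

Ltac op_head p :=
  lazymatch p with
  | @tensm _ _ _ _ _ (@idm _ _) ?p' =>
    let r := op_head p' in lazymatch r with (?f, ?d) => constr:((f, S d)) end
  | @lift _ _ _ ?f _ => constr:((f, 0))
  end.

Ltac eq_head rev E :=
  lazymatch type of E with
  | forall x : ?A, _ =>
    let y := fresh "x" in
    let r := constr:(fun y : A => ltac:(let r := eq_head rev (E y) in exact r)) in
    lazymatch r with fun _ => ?t => t end
  | @eq _ ?l ?r =>
    let m := lazymatch rev with true => r | false => l end in
    lazymatch m with @comp _ _ _ _ ?p _ => op_head p | _ => op_head m end
  end.

(** Before a rule is whiskered by [n] strands, the goal is checked to contain its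
first operation at the corresponding depth. *)
Ltac goal_has f d := idtac;
  match goal with
  | |- context [@comp _ _ _ _ ?p _] =>
    let r := op_head p in lazymatch r with (f, d) => idtac end
  end.

Ltac try_depths tac f d n := idtac;
  lazymatch n with
  | 7 => fail
  | _ =>
    first [ goal_has f d; tac n
          | let d' := constr:(S d) in let n' := constr:(S n) in try_depths tac f d' n' ]
  end.

Ltac rw0 E := idtac;
  let h := eq_head false E in
  lazymatch h with (?f, ?d) => try_depths ltac:(fun n => rw_whisk n E) f d 0 end.

Ltac rwl0 E := idtac;
  let h := eq_head true E in
  lazymatch h with (?f, ?d) => try_depths ltac:(fun n => rwl_whisk n E) f d 0 end.

Ltac late f := repeat
  match goal with
  | |- context [@comp _ _ _ _ ?p (@comp _ _ _ _ ?q ?k)] =>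
    let r := op_head q in lazymatch r with (f, _) => idtac end;
    let r := op_head p in lazymatch r with (f, _) => fail | _ => idtac end;
    first [let e := swapL p q in rewrite_swap e k | let e := swapR p q in rewrite_swap e k]
  end.

Ltac early f := repeat
  match goal with
  | |- context [@comp _ _ _ _ ?p (@comp _ _ _ _ ?q ?k)] =>
    let r := op_head p in lazymatch r with (f, _) => idtac end;
    let r := op_head q in lazymatch r with (f, _) => fail | _ => idtac end;
    first [let e := swapL p q in rewrite_swap e k | let e := swapR p q in rewrite_swap e k]
  end.

Ltac chain_ops m :=
  lazymatch m with
  | @comp _ _ _ _ ?p ?q =>
    let r := op_head p in
    let l := chain_ops q in
    lazymatch r with (?f, _) => constr:((f, l)) end
  | _ => let r := op_head m in lazymatch r with (?f, _) => constr:((f, tt)) end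
  end.

Ltac eq_ops rev E :=
  lazymatch type of E with
  | forall x : ?A, _ =>
    let y := fresh "x" in
    let r := constr:(fun y : A => ltac:(let r := eq_ops rev (E y) in exact r)) in
    lazymatch r with fun _ => ?t => t end
  | @eq _ ?l ?r =>
    let m := lazymatch rev with true => r | false => l end in chain_ops m
  end.

Ltac late_all l := idtac;
  lazymatch l with
  | (?f, ?l) => late f; late_all l
  | _ => idtac
  end.

(** The operations of the rule are moved towards its last one; this finds
occurrences that are contiguous in neither of the two orders above. *)
Ltac gather rev E := idtac;
  let l := eq_ops rev E in
  lazymatch l with (?f, ?l) => early f; late_all l end.

(** The rule is tried on several orders of execution of the goal, its own order
being changed accordingly. *)
Ltac modulo rev tac E := idtac; first
  [ tac E
  | nfR; let E1 := nf_eq true E in tac E1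
  | nfL; let E2 := nf_eq false E in tac E2
  | gather rev E;
    first [tac E | let E1 := nf_eq true E in tac E1 | let E2 := nf_eq false E in tac E2] ].

Ltac rw_chain E := modulo false ltac:(fun E => rw0 E) E.
Ltac rwl_chain E := modulo true ltac:(fun E => rwl0 E) E.
Ltac rwl_chain_at n E := modulo true ltac:(fun E => rwl_whisk n E) E.

(** Rewriting a chain with an equation of morphisms, from left to right or from
right to left; [rwl_at n] fixes the number of strands on the left. *)
Ltac rw E := let r := strict E in rw_chain r.
Ltac rwl E := let r := strict E in rwl_chain r.
Ltac rwl_at n E := let r := strict E in rwl_chain_at n r.

Ltac cross_eq f y :=
  lazymatch type of f with @hom (mon_cat (br_mon ?C)) ?a ?b =>
    let s := reify_ob a in let t := reify_ob b in
    let e := constr:(@cross_natural C s t f y) in simp_eq e end.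
Ltac crossr_eq f y :=
  lazymatch type of f with @hom (mon_cat (br_mon ?C)) ?a ?b =>
    let s := reify_ob a in let t := reify_ob b in
    let e := constr:(@crossr_natural C s t f y) in simp_eq e end.
(** Moving [f] through a braiding with the strand [y]: from before the braiding to
after it ([postpone]) or back ([advance]). Before the braiding [y] is on the
right of [f]; for the primed versions it is on the left. *)
Ltac postpone f y := let r := cross_eq f y in rw_chain r.
Ltac advance f y := let r := cross_eq f y in rwl_chain r.
Ltac postpone' f y := let r := crossr_eq f y in rw_chain r.
Ltac advance' f y := let r := crossr_eq f y in rwl_chain r.

Ltac strictify :=
  lazymatch goal with
  | |- @eq (@hom ?c ?x ?y) ?f ?g =>
    let s := reify_ob x in let t := reify_ob y in
    apply (@lift_inj _ s t);
    let z := fresh "z" in intros z;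
    let p := lift_eq s t f z in
    let q := lift_eq s t g z in
    refine (eq_trans p (eq_trans _ (eq_sym q)));
    cbn [ev flat flat_map cross crossr];
    apply ext_post;
    let w := fresh "w" in let k := fresh "k" in intros w k;
    simp
  end.

(** Some rules, such as associativity, also apply to the other side of the goal;
these restrict rewriting to one side. *)
Tactic Notation "lhs" tactic3(tac) := etransitivity; [tac; reflexivity |].
Tactic Notation "rhs" tactic3(tac) := symmetry; etransitivity; [tac; reflexivity |]; symmetry.

Ltac close := first [reflexivity | nfR; reflexivity | nfL; reflexivity].

(** * Isomorphisms *)

Section Isos.
Variable C : category.
Implicit Types x y z : C.

Lemma is_iso_comp x y z (g : y ~> z) (f : x ~> y) : is_iso g -> is_iso f -> is_iso (g ∘ f).
Proof.
  intros (g' & g'g & gg') (f' & f'f & ff'). exists (f' ∘ g'). split.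
  - rewrite <- compA, (compA g'), g'g, comp1m. exact f'f.
  - rewrite <- compA, (compA f), ff', comp1m. exact gg'.
Qed.

Lemma is_iso_sym x y (f : x ~> y) g : g ∘ f = \id x -> f ∘ g = \id y -> is_iso g.
Proof. intros gf fg. exists f. split; assumption. Qed.

Lemma is_iso_cancel_l x y z (g : y ~> z) (f : x ~> y) : is_iso g -> is_iso (g ∘ f) -> is_iso f.
Proof.
  intros (g' & g'g & gg') h.
  rewrite <- (comp1m f), <- g'g, <- compA. apply is_iso_comp; [exact (is_iso_sym g'g gg') | exact h].
Qed.

Lemma is_iso_cancel_r x y z (g : y ~> z) (f : x ~> y) : is_iso f -> is_iso (g ∘ f) -> is_iso g.
Proof.
  intros (f' & f'f & ff') h.
  rewrite <- (compm1 g), <- ff', compA. apply is_iso_comp; [exact h | exact (is_iso_sym f'f ff')].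
Qed.

End Isos.

Lemma is_iso_tens (C : monoidal_category) (x y x' y' : C) (f : x ~> y) (g : x' ~> y') :
  is_iso f -> is_iso g -> is_iso (f ⊠ g).
Proof.
  intros (f' & f'f & ff') (g' & g'g & gg'). exists (f' ⊠ g').
  rewrite <- !tensm_comp, f'f, ff', g'g, gg', !tensm_id. split; reflexivity.
Qed.

Lemma is_iso_id (C : category) (x : C) : is_iso (\id x).
Proof. exists (\id x). split; apply comp1m. Qed.

Lemma is_iso_assoc (C : monoidal_category) (x y z : C) : is_iso (assoc x y z).
Proof. exists (assocV x y z). split; [apply assocK | apply assocVK]. Qed.

Lemma is_iso_assocV (C : monoidal_category) (x y z : C) : is_iso (assocV x y z).
Proof. exists (assoc x y z). split; [apply assocVK | apply assocK]. Qed.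

(** * Convolution and twists *)

Record is_coalgebra (C : monoidal_category) (D : C) (cm : D ~> D ⊗ D) (cu : D ~> \I) : Prop :=
  IsCoalgebra {
  coalgA : assoc D D D ∘ (cm ⊠ \id D) ∘ cm = (\id D ⊠ cm) ∘ cm;
  coalg1l : lunit D ∘ (cu ⊠ \id D) ∘ cm = \id D;
  coalg1r : runit D ∘ (\id D ⊠ cu) ∘ cm = \id D
}.

Section Convolution.
Variables (C : braided_category) (D : C) (cm : D ~> D ⊗ D) (cu : D ~> \I).
Variable B : algebra C.
Hypothesis coalgP : is_coalgebra cm cu.

Definition conv (s t : D ~> B) : D ~> B := mul B ∘ (s ⊠ t) ∘ cm.

(** In element notation, [b ⊗ d |-> b s(d1) ⊗ d2]. *)
Definition twist (s : D ~> B) : B ⊗ D ~> B ⊗ D :=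
  (mul B ⊠ \id D) ∘ assocV B B D ∘ (\id B ⊠ ((s ⊠ \id D) ∘ cm)).

Lemma twist_comp s t : twist t ∘ twist s = twist (conv s t).
Proof.
  unfold twist, conv. strictify.
  rwl (coalgA coalgP).
  rw (algA (algP B)). close.
Qed.

Lemma twist_unit : twist (one B ∘ cu) = \id _.
Proof.
  unfold twist. strictify.
  rw (algm1 (algP B)). rw (coalg1l coalgP). close.
Qed.

(** The unit and the counit recover [s] from its twist. *)
Lemma twist_inj s t : twist s = twist t -> s = t.
Proof.
  intros h.
  assert (e : forall s, runit B ∘ (\id B ⊠ cu) ∘ twist s ∘ (one B ⊠ \id D) ∘ lunitV D = s).
  { clear s t h. intros s. unfold twist. strictify.
    rw (alg1m (algP B)). rw (coalg1r coalgP). close. }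
  rewrite <- (e s), h. apply e.
Qed.

Lemma twist_linear s :
  twist s ∘ (mul B ⊠ \id D) = (mul B ⊠ \id D) ∘ assocV B B D ∘ (\id B ⊠ twist s) ∘ assoc B B D.
Proof. unfold twist. strictify. rw (algA (algP B)). close. Qed.

Lemma twist_colinear s :
  (\id B ⊠ cm) ∘ twist s = assoc B D D ∘ (twist s ⊠ \id D) ∘ assocV B D D ∘ (\id B ⊠ cm).
Proof. unfold twist. strictify. rw (coalgA coalgP). close. Qed.

Definition conv_invertible (s : D ~> B) : Prop :=
  exists t : D ~> B, conv s t = one B ∘ cu /\ conv t s = one B ∘ cu.

(** The inverse of a twist is linear and colinear because the twist is, and such
an endomorphism is determined by its value on [1 ⊗ d] followed by the counit:
it is itself a twist. *)
Lemma conv_invertibleP s : conv_invertible s <-> is_iso (twist s).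
Proof.
  split.
  { intros [t [st ts]]. exists (twist t). rewrite !twist_comp, st, ts, twist_unit. split; reflexivity. }
  intros [g [gs sg]].
  set (t := runit B ∘ (\id B ⊠ cu) ∘ g ∘ (one B ⊠ \id D) ∘ lunitV D).
  assert (lin : g ∘ (mul B ⊠ \id D) = (mul B ⊠ \id D) ∘ assocV B B D ∘ (\id B ⊠ g) ∘ assoc B B D).
  { apply (mono_of_retraction gs). strictify. rw (twist_linear s). rw sg. rw sg. close. }
  assert (colin : (\id B ⊠ cm) ∘ g = assoc B D D ∘ (g ⊠ \id D) ∘ assocV B D D ∘ (\id B ⊠ cm)).
  { apply (epi_of_section sg). strictify. rw (twist_colinear s). rw gs. rw gs. close. }
  assert (e : twist t = g).
  { unfold twist, t. strictify. rwl colin. rw (coalg1l coalgP). rwl lin. rw (algm1 (algP B)). close. }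
  exists t. split; apply twist_inj; rewrite twist_unit, <- twist_comp, e; assumption.
Qed.

End Convolution.

(** * The coalgebras [H] and [H ⊗ H] *)

Section HopfCoalgebras.
Variables (C : braided_category) (H : hopf_algebra C).

Lemma hopf_coalgebra : is_coalgebra (comul H) (counit H).
Proof. split; [apply comulA | apply counitl | apply counitr]. Qed.

(** By naturality of the braiding all comultiplications can be executed first;
what is left is coassociativity in each of the two factors. *)
Lemma comul2_coalgebra : is_coalgebra (comul2 H) (counit2 H).
Proof.
  split; strictify.
  - advance' (comul H) H. advance (comul H) H.
    rw (@comulA _ H). rw (@comulA _ H). close.
  - advance' (counit H) H. rw (@counitl _ H). rw (@counitl _ H). close.
  - advance (counit H) H. rw (@counitr _ H). rw (@counitr _ H). close.
Qed.

Lemma conv_antipode : conv_invertible (comul H) (counit H) (\id H : H ~> hopf_alg H).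
Proof.
  exists (antipode H). split; [apply antipoder | apply antipodel].
Qed.

(** [k ⊗ h |-> k h1 ⊗ h2] has inverse [k ⊗ h |-> k S(h1) ⊗ h2]. *)
Lemma hopf_galois : is_iso (twist (comul H) (\id H : H ~> hopf_alg H)).
Proof. exact (proj1 (conv_invertibleP hopf_coalgebra _) conv_antipode). Qed.

End HopfCoalgebras.

(** * From cleft extensions to crossed products *)

Lemma is_algebra_transport (C : braided_category) (A : algebra C) (X : C)
    (m : X ⊗ X ~> X) (u : \I ~> X) (f : X ~> A) :
  is_iso f -> f ∘ m = mul A ∘ (f ⊠ f) -> f ∘ u = one A -> is_algebra m u.
Proof.
  intros [g [gf fg]] fm fu. split; apply (mono_of_retraction gf); strictify.
  - rw fm. rw fm. rw fm. rw fm. rw (algA (algP A)). close.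
  - rw fm. rw fu. rw (alg1m (algP A)). close.
  - rw fm. rw fu. rw (algm1 (algP A)). close.
Qed.

Section Cleft.
Variables (C : braided_category) (H : hopf_algebra C) (A B : algebra C).

(** In element notation the last two conditions are
[gam(h) p(b) = p(alpha(h1, b)) gam(h2)] and
[gam(h) gam(k) = p(sigma(h1, k1)) gam(h2 k2)]. *)
Record is_cleft (p : B ~> A) (gam : H ~> A) (alpha : H ⊗ B ~> B) (sigma : H ⊗ H ~> B)
    : Prop := IsCleft {
  cleft_alg : is_algebra_morphism p;
  cleft_one : gam ∘ one H = one A;
  cleft_iso : is_iso (mul A ∘ (p ⊠ gam));
  cleft_act : mul A ∘ (gam ⊠ p)
    = mul A ∘ (p ⊠ gam) ∘ (alpha ⊠ \id H) ∘ assocV H B H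
      ∘ (\id H ⊠ braid H B) ∘ assoc H H B ∘ (comul H ⊠ \id B);
  cleft_mul : mul A ∘ (gam ⊠ gam)
    = mul A ∘ (p ⊠ gam) ∘ (sigma ⊠ mul H) ∘ comul2 H
}.

Section ToCrossed.
Variables (p : B ~> A) (gam : H ~> A) (alpha : H ⊗ B ~> B) (sigma : H ⊗ H ~> B).
Hypothesis cleftP : is_cleft p gam alpha sigma.
Variable Ji : A ~> B ⊗ H.
Hypothesis JiJ : Ji ∘ mul A ∘ (p ⊠ gam) = \id _.
Hypothesis JJi : (mul A ∘ (p ⊠ gam)) ∘ Ji = \id _.

(** The [B]-coordinate: [p(b) gam(h) |-> b counit(h)]. *)
Definition base_part : A ~> B := runit B ∘ (\id B ⊠ counit H) ∘ Ji.

Let pm := proj1 (cleft_alg cleftP).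
Let pu := proj2 (cleft_alg cleftP).
Let gu := cleft_one cleftP.
Let gp := cleft_act cleftP.
Let gg := cleft_mul cleftP.
Let mA := algA (algP A).

Lemma gam_basis : gam = mul A ∘ (p ⊠ gam) ∘ (one B ⊠ \id H) ∘ lunitV H.
Proof. strictify. rw pu. rw (alg1m (algP A)). close. Qed.

Lemma p_basis : p = mul A ∘ (p ⊠ gam) ∘ (\id B ⊠ one H) ∘ runitV B.
Proof. strictify. rw gu. rw (algm1 (algP A)). close. Qed.

Lemma base_part_basis : base_part ∘ mul A ∘ (p ⊠ gam) = runit B ∘ (\id B ⊠ counit H).
Proof. unfold base_part. strictify. rw JiJ. close. Qed.

Lemma base_part_linear : base_part ∘ mul A ∘ (p ⊠ \id A) = mul B ∘ (\id B ⊠ base_part).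
Proof.
  assert (e : (\id B ⊠ (mul A ∘ (p ⊠ gam))) ∘ (\id B ⊠ Ji) = \id _).
  { rewrite <- whisk_comp, JJi, whisk_id. reflexivity. }
  apply (epi_of_section e). strictify.
  rwl mA. rwl pm. rw base_part_basis. rw base_part_basis. close.
Qed.

(** Together with [base_part_mul] this recovers the action and the cocycle from
products in [A], so that their axioms reduce to associativity there. *)
Lemma base_part_act : base_part ∘ mul A ∘ (gam ⊠ p) = alpha.
Proof.
  strictify. rw gp. rw base_part_basis. advance (counit H) B. rw (@counitr _ H). close.
Qed.

Lemma base_part_mul : base_part ∘ mul A ∘ (gam ⊠ gam) = sigma.
Proof.
  strictify. rw gg. rw base_part_basis. rw (@counit_mul _ H).
  advance (counit H) H. rw (@counitr _ H). rw (@counitr _ H). close.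
Qed.

Lemma base_part_gam : base_part ∘ gam = one B ∘ counit H.
Proof.
  strictify. rw gam_basis. rw base_part_basis. close.
Qed.

Lemma cleft_weak_action : is_weak_action alpha.
Proof.
  split.
  - apply (eq_trans (y := base_part ∘ mul A ∘ (gam ⊠ (p ∘ mul B)))).
    { strictify. rw base_part_act. close. }
    strictify. rw pm. rwl mA. rw gp. rw mA. rw base_part_linear. rw base_part_act. close.
  - apply (eq_trans (y := base_part ∘ mul A ∘ (gam ⊠ (p ∘ one B)) ∘ runitV H)).
    { strictify. rw base_part_act. close. }
    strictify. rw pu. rw (algm1 (algP A)). rw base_part_gam. close.
Qed.

Lemma cleft_cocycle : is_cocycle alpha sigma.
Proof.
  split; [|split].
  (* both sides are the B-coordinate of gam(h) gam(k) gam(l) *)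
  - apply (eq_trans (y := base_part ∘ mul A ∘ (mul A ⊠ \id A) ∘ ((gam ⊠ gam) ⊠ gam))).
    + strictify. rw mA. rw gg. rwl mA. rw gp. rw mA. rw base_part_linear. rw base_part_mul. close.
    + strictify. rw gg. rw mA. rw base_part_linear. rw base_part_mul. close.
  - apply (eq_trans (y := base_part ∘ mul A ∘ (gam ⊠ (gam ∘ one H)) ∘ runitV H)).
    { strictify. rw base_part_mul. close. }
    strictify. rw gu. rw (algm1 (algP A)). rw base_part_gam. close.
  - apply (eq_trans (y := base_part ∘ mul A ∘ ((gam ∘ one H) ⊠ gam) ∘ lunitV H)).
    { strictify. rw base_part_mul. close. }
    strictify. rw gu. rw (alg1m (algP A)). rw base_part_gam. close.
Qed.

(** [p(b) gam(h) p(b') gam(h')] is expanded with the two commutation relations. *)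
Lemma basis_crossed_mul : (mul A ∘ (p ⊠ gam)) ∘ crossed_mul alpha sigma
  = mul A ∘ ((mul A ∘ (p ⊠ gam)) ⊠ (mul A ∘ (p ⊠ gam))).
Proof.
  unfold crossed_mul. strictify. rw pm. rw pm.
  rw mA. rw mA. rw mA. rhs (rwl_at 1 mA; rw gp; rw mA; rw gg). close.
Qed.

Lemma basis_crossed_one : (mul A ∘ (p ⊠ gam)) ∘ crossed_one H B = one A.
Proof.
  unfold crossed_one. strictify. rw pu. rw gu. rw (alg1m (algP A)). close.
Qed.

End ToCrossed.
End Cleft.

(** * From crossed products to cleft extensions *)

Section FromCrossed.
Variables (C : braided_category) (H : hopf_algebra C) (B : algebra C).
Variables (alpha : H ⊗ B ~> B) (sigma : H ⊗ H ~> B).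
Hypothesis alpha1 : alpha ∘ (\id H ⊠ one B) ∘ runitV H = one B ∘ counit H.
Hypothesis sigmar : sigma ∘ (\id H ⊠ one H) ∘ runitV H = one B ∘ counit H.
Hypothesis sigmal : sigma ∘ (one H ⊠ \id H) ∘ lunitV H = one B ∘ counit H.
Hypothesis crossP : is_algebra (crossed_mul alpha sigma) (crossed_one H B).

Definition base_inclusion : B ~> B ⊗ H := (\id B ⊠ one H) ∘ runitV B.
Definition hopf_inclusion : H ~> B ⊗ H := (one B ⊠ \id H) ∘ lunitV H.

(** A weak action need not satisfy [alpha(1, b) = b]; this comes from the unit law
of the crossed product, applied to [(1 # 1)(b # 1)]. *)
Lemma action_one : alpha ∘ (one H ⊠ \id B) ∘ lunitV B = \id B.
Proof.
  assert (h := alg1m crossP).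
  apply (f_equal (fun f =>
    runit B ∘ (\id B ⊠ counit H) ∘ f ∘ (\id \I ⊠ base_inclusion) ∘ lunitV B)) in h.
  unfold crossed_mul, crossed_one, base_inclusion in h.
  transitivity (runit B ∘ (\id B ⊠ counit H) ∘ lunit (B ⊗ H)
    ∘ (\id \I ⊠ base_inclusion) ∘ lunitV B).
  - refine (eq_trans _ h). clear h. strictify.
    rw (@comul_one _ H). postpone (one H) B. do 2 rw (@comul_one _ H). postpone (one H) H.
    (* counit(1 1) is evaluated while it is still connected to sigma(1, 1) *)
    rw (algm1 (algP H)). rw (@counit_one _ H). rw sigmar. rw (@counit_one _ H).
    rw (algm1 (algP B)). rw (alg1m (algP B)). close.
  - unfold base_inclusion. strictify. rw (@counit_one _ H). close.
Qed.

Lemma crossed_base_l :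
  crossed_mul alpha sigma ∘ (base_inclusion ⊠ \id (B ⊗ H)) = (mul B ⊠ \id H) ∘ assocV B B H.
Proof.
  unfold crossed_mul, base_inclusion. strictify.
  rw (@comul_one _ H). postpone (one H) B. rw action_one. rw (@comul_one _ H). postpone (one H) H.
  rw sigmal. rw (alg1m (algP H)). rw (@counitl _ H). rw (algm1 (algP B)). close.
Qed.

Lemma crossed_hopf_base : crossed_mul alpha sigma ∘ (hopf_inclusion ⊠ base_inclusion)
  = (alpha ⊠ \id H) ∘ assocV H B H ∘ (\id H ⊠ braid H B) ∘ assoc H H B ∘ (comul H ⊠ \id B).
Proof.
  unfold crossed_mul, base_inclusion, hopf_inclusion. strictify.
  rw (@comul_one _ H). postpone' (one H) H. rw sigmar. rw (algm1 (algP H)). rw (@counitl _ H).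
  rw (alg1m (algP B)). rw (algm1 (algP B)). close.
Qed.

Lemma crossed_hopf_hopf :
  crossed_mul alpha sigma ∘ (hopf_inclusion ⊠ hopf_inclusion) = (sigma ⊠ mul H) ∘ comul2 H.
Proof.
  unfold crossed_mul, hopf_inclusion. strictify.
  postpone' (one B) H. rw alpha1. rw (@counitl _ H).
  rw (alg1m (algP B)). rw (alg1m (algP B)). close.
Qed.

Variables (A : algebra C) (f : A ~> B ⊗ H) (g : B ⊗ H ~> A).
Hypothesis fm : f ∘ mul A = crossed_mul alpha sigma ∘ (f ⊠ f).
Hypothesis fu : f ∘ one A = crossed_one H B.
Hypothesis gf : g ∘ f = \id A.
Hypothesis fg : f ∘ g = \id (B ⊗ H).

Lemma crossed_basis : f ∘ mul A ∘ ((g ∘ base_inclusion) ⊠ (g ∘ hopf_inclusion)) = \id _.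
Proof.
  rewrite compA, fm, <- compA, <- tensm_comp, !compA, fg, !comp1m.
  rewrite (exchange base_inclusion), (compA (crossed_mul _ _)), crossed_base_l.
  unfold hopf_inclusion. strictify. rw (algm1 (algP B)). close.
Qed.

Lemma crossed_cleft : is_cleft (g ∘ base_inclusion) (g ∘ hopf_inclusion) alpha sigma.
Proof.
  assert (J : f ∘ (mul A ∘ ((g ∘ base_inclusion) ⊠ (g ∘ hopf_inclusion))) = \id _).
  { apply crossed_basis. }
  assert (m2 : forall x y (a : x ~> B ⊗ H) (b : y ~> B ⊗ H),
    f ∘ (mul A ∘ ((g ∘ a) ⊠ (g ∘ b))) = crossed_mul alpha sigma ∘ (a ⊠ b)).
  { intros x y a b. rewrite compA, fm, <- compA, <- tensm_comp, !compA, fg, !comp1m. reflexivity. }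
  split.
  - split; apply (mono_of_retraction gf).
    + rewrite m2, !compA, fg, comp1m, (exchange base_inclusion base_inclusion), compA, crossed_base_l.
      unfold base_inclusion. strictify. close.
    + rewrite fu, !compA, fg, comp1m. unfold base_inclusion, crossed_one. strictify. close.
  - apply (mono_of_retraction gf).
    rewrite fu, !compA, fg, comp1m. unfold hopf_inclusion, crossed_one. strictify. close.
  - exists f. split; [exact J|].
    apply (mono_of_retraction gf). rewrite compA, J, comp1m, compm1. reflexivity.
  - apply (mono_of_retraction gf).
    rewrite m2, crossed_hopf_base, (compA (mul A)), (compA f), J, comp1m. reflexivity.
  - apply (mono_of_retraction gf).
    rewrite m2, crossed_hopf_hopf, (compA (mul A)), (compA f), J, comp1m. reflexivity.
Qed.

End FromCrossed.

Section CleftCrossed.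
Variables (C : braided_category) (H : hopf_algebra C) (A B : algebra C).

Definition cleft_extension : Prop :=
  exists (p : B ~> A) (gam : H ~> A) (alpha : H ⊗ B ~> B) (sigma : H ⊗ H ~> B),
    is_cleft p gam alpha sigma /\ is_convolution_invertible sigma.

Lemma crossed_productP :
  (exists (alpha : H ⊗ B ~> B) (sigma : H ⊗ H ~> B),
      is_weak_action alpha /\
      is_cocycle alpha sigma /\
      is_convolution_invertible sigma /\
      exists assoc_unital : is_algebra (crossed_mul alpha sigma) (crossed_one H B),
        algebra_isomorphic A (crossed_product assoc_unital))
  <-> cleft_extension.
Proof.
  split.
  - intros (alpha & sigma & [_ a1] & (_ & s1 & s2) & inv & au & f & [fm fu] & g & gf & fg).
    exists (g ∘ base_inclusion H B), (g ∘ hopf_inclusion H B), alpha, sigma. split; [|exact inv].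
    exact (crossed_cleft a1 s1 s2 au fm fu gf fg).
  - intros (p & gam & alpha & sigma & cl & inv).
    destruct (cleft_iso cl) as (Ji & JiJ & JJi).
    exists alpha, sigma.
    split; [exact (cleft_weak_action cl JiJ JJi)|].
    split; [exact (cleft_cocycle cl JiJ JJi)|].
    split; [exact inv|].
    assert (au : is_algebra (crossed_mul alpha sigma) (crossed_one H B)).
    { exact (is_algebra_transport (cleft_iso cl) (basis_crossed_mul cl) (basis_crossed_one cl)). }
    assert (Jm : Ji ∘ mul A = crossed_mul alpha sigma ∘ (Ji ⊠ Ji)).
    { apply (mono_of_retraction JiJ).
      rewrite !compA, (basis_crossed_mul cl), JJi, comp1m, <- compA, <- tensm_comp, JJi, tensm_id,
        compm1. reflexivity. }
    assert (Ju : Ji ∘ one A = crossed_one H B).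
    { apply (mono_of_retraction JiJ). rewrite (basis_crossed_one cl), compA, JJi. apply comp1m. }
    exists au, Ji. split; [split; assumption|].
    exists (mul A ∘ (p ⊠ gam)). split; assumption.
Qed.

End CleftCrossed.

(** * From cleft extensions to Galois extensions *)

Section Galois.
Variables (C : braided_category) (H : hopf_algebra C) (A B : algebra C).
Variables (p : B ~> A) (gam : H ~> A) (alpha : H ⊗ B ~> B) (sigma : H ⊗ H ~> B).
Hypothesis cleftP : is_cleft p gam alpha sigma.

Let pm := proj1 (cleft_alg cleftP).
Let pu := proj2 (cleft_alg cleftP).
Let gu := cleft_one cleftP.
Let gp := cleft_act cleftP.
Let gg := cleft_mul cleftP.
Let mA := algA (algP A).

(** The relation between [gam] and [sigma] applied to [gam(k) gam(h1)] gives
[b gam(k) gam(h1) ⊗ h2 = b sigma(k1, h1) gam(k2 h2) ⊗ h3]; the right-hand side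
is obtained by first twisting with [sigma] and then multiplying [k2] by [h2]. *)
Lemma twist_basis : twist (comul H) gam ∘ ((mul A ∘ (p ⊠ gam)) ⊠ \id H)
  = ((mul A ∘ (p ⊠ gam)) ⊠ \id H) ∘ assocV B H H
    ∘ (\id B ⊠ twist (comul H) (\id H : H ~> hopf_alg H)) ∘ twist (comul2 H) sigma ∘ assoc B H H.
Proof.
  unfold twist. strictify.
  rw mA. rw gg. rw pm. rw mA. rw (@comulA _ H). close.
Qed.

(** All factors in [twist_basis] other than the two twists are isomorphisms. *)
Lemma twist_invertible : conv_invertible (comul2 H) (counit2 H) sigma <-> is_iso (twist (comul H) gam).
Proof.
  assert (J2 : is_iso ((mul A ∘ (p ⊠ gam)) ⊠ \id H)).
  { exact (is_iso_tens (cleft_iso cleftP) (is_iso_id _)). }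
  assert (X : is_iso (\id B ⊠ twist (comul H) (\id H : H ~> hopf_alg H))).
  { exact (is_iso_tens (is_iso_id _) (hopf_galois H)). }
  split; intros h.
  - apply (proj1 (conv_invertibleP (comul2_coalgebra H) _)) in h.
    apply (is_iso_cancel_r J2). rewrite twist_basis.
    exact (is_iso_comp J2 (is_iso_comp (is_iso_assocV _ _ _)
      (is_iso_comp X (is_iso_comp h (is_iso_assoc _ _ _))))).
  - apply (proj2 (conv_invertibleP (comul2_coalgebra H) _)).
    assert (k := is_iso_comp h J2). rewrite twist_basis in k.
    apply (is_iso_cancel_l J2), (is_iso_cancel_l (is_iso_assocV _ _ _)), (is_iso_cancel_l X) in k.
    exact (is_iso_cancel_r (is_iso_assoc _ _ _) k).
Qed.

Variable Ji : A ~> B ⊗ H.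
Hypothesis JiJ : Ji ∘ mul A ∘ (p ⊠ gam) = \id _.
Hypothesis JJi : (mul A ∘ (p ⊠ gam)) ∘ Ji = \id _.

(** The coaction [B ⊗ comul] transported along the basis. *)
Definition coaction : A ~> A ⊗ H := ((mul A ∘ (p ⊠ gam)) ⊠ \id H) ∘ cofree_coaction H B ∘ Ji.

Lemma coaction_basis : coaction ∘ mul A ∘ (p ⊠ gam)
  = ((mul A ∘ (p ⊠ gam)) ⊠ \id H) ∘ assocV B H H ∘ (\id B ⊠ comul H).
Proof. unfold coaction. strictify. rw JiJ. close. Qed.

Lemma coaction_gam : coaction ∘ gam = (gam ⊠ \id H) ∘ comul H.
Proof.
  strictify. lhs (rw (gam_basis cleftP); rw coaction_basis; rw pu; rw (alg1m (algP A))). close.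
Qed.

Lemma coaction_linear : coaction ∘ mul A ∘ (p ⊠ \id A)
  = (mul A ⊠ \id H) ∘ assocV A A H ∘ (p ⊠ coaction).
Proof.
  assert (e : (\id B ⊠ (mul A ∘ (p ⊠ gam))) ∘ (\id B ⊠ Ji) = \id _).
  { rewrite <- whisk_comp, JJi, whisk_id. reflexivity. }
  apply (epi_of_section e). strictify.
  lhs (rwl mA; rwl pm; rw coaction_basis; rw pm; rw mA). rw coaction_basis. close.
Qed.

Lemma coaction_p : coaction ∘ p = (p ⊠ one H) ∘ runitV B.
Proof.
  strictify. lhs (rw (p_basis cleftP); rw coaction_basis; rw (@comul_one _ H); rw gu; rw (algm1 (algP A))).
  close.
Qed.

(** The coaction is multiplicative first on products [gam(h) gam(k)], then on
[gam(h) p(b) gam(k)] by moving [gam(h)] past [p(b)], then in general by left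
[B]-linearity. *)
Lemma coaction_mul_gam : coaction ∘ mul A ∘ (gam ⊠ gam)
  = (mul A ⊠ mul H) ∘ interchange A H A H
    ∘ (((gam ⊠ \id H) ∘ comul H) ⊠ ((gam ⊠ \id H) ∘ comul H)).
Proof.
  strictify.
  lhs (rw gg; rw coaction_linear; rw coaction_gam; rw (@comul_mul _ H)).
  postpone' gam H. rhs (rw gg). 
  advance' (comul H) H. advance (comul H) H. rw (@comulA _ H). rw (@comulA _ H). close.
Qed.

Lemma coaction_mul_gam_basis : coaction ∘ mul A ∘ (gam ⊠ (mul A ∘ (p ⊠ gam)))
  = (mul A ⊠ mul H) ∘ interchange A H A H
    ∘ (((gam ⊠ \id H) ∘ comul H) ⊠ (((mul A ∘ (p ⊠ gam)) ⊠ \id H) ∘ cofree_coaction H B)).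
Proof.
  strictify.
  lhs (rwl mA; rw gp; rw mA; rw coaction_linear; rw coaction_mul_gam).
  rhs (postpone' (mul A) H; postpone' p H; rwl mA; rw gp; rw mA).
  advance (comul H) B. rw (@comulA _ H). close.
Qed.

Lemma coaction_mul : coaction ∘ mul A = (mul A ⊠ mul H) ∘ interchange A H A H ∘ (coaction ⊠ coaction).
Proof.
  assert (e : ((mul A ∘ (p ⊠ gam)) ⊠ (mul A ∘ (p ⊠ gam))) ∘ (Ji ⊠ Ji) = \id _).
  { rewrite <- tensm_comp, JJi. apply tensm_id. }
  apply (epi_of_section e). strictify.
  lhs (rw mA; rw coaction_linear; rw coaction_mul_gam_basis).
  rhs (rw coaction_basis; rw coaction_basis; rw mA). close.
Qed.

Lemma coaction_one : coaction ∘ one A = (one A ⊠ one H) ∘ lunitV \I.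
Proof.
  strictify. lhs (rwl pu; rw coaction_p; rw pu). close.
Qed.

Lemma coaction_comodule : is_comodule coaction.
Proof.
  split; apply (epi_of_section JJi); strictify.
  - rw coaction_basis. rw coaction_basis. rw (@comulA _ H). close.
  - rw coaction_basis. rw (@counitr _ H). close.
Qed.

(** The coordinates of [a] in the basis are [base_part(a0) ⊗ a1], by colinearity
and the counit; hence [a = p(base_part(a0)) gam(a1)]. *)
Lemma basis_decomposition : mul A ∘ ((p ∘ base_part Ji) ⊠ gam) ∘ coaction = \id A.
Proof.
  apply (epi_of_section JJi). strictify.
  rw coaction_basis. rw (base_part_basis JiJ). rw (@counitl _ H). close.
Qed.

Lemma base_part_p : base_part Ji ∘ p = \id B.
Proof.
  strictify. rw (p_basis cleftP). rw (base_part_basis JiJ). rw (@counit_one _ H). close.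
Qed.

(** If [a0 ⊗ a1 = a ⊗ 1], the decomposition above gives [a = p(base_part(a))]. *)
Lemma coaction_coinvariants : is_coinvariants coaction p.
Proof.
  split; [exact (cleft_alg cleftP)|]. split.
  - rewrite coaction_p. strictify. close.
  - intros z h hz. exists (base_part Ji ∘ h). split.
    + apply (eq_trans (y := (mul A ∘ ((p ∘ base_part Ji) ⊠ gam) ∘ coaction) ∘ h)).
      * strictify. rw hz. rw gu. rw (algm1 (algP A)). close.
      * rewrite basis_decomposition. apply comp1m.
    + intros k <-. rewrite compA, base_part_p. apply comp1m.
Qed.

Lemma can'_gam : can' coaction ∘ (\id A ⊠ gam) = twist (comul H) gam.
Proof. unfold twist. strictify. rw coaction_gam. close. Qed.

Variable Phi' : A ⊗ H ~> A ⊗ H.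
Hypothesis PhiK : Phi' ∘ twist (comul H) gam = \id _.
Hypothesis PhiK' : twist (comul H) gam ∘ Phi' = \id _.

Lemma can'_section : can' coaction ∘ (\id A ⊠ gam) ∘ Phi' = \id _.
Proof. rewrite compA, can'_gam. exact PhiK'. Qed.

(** The section of [can'] sends [can'(a ⊗ p(b) gam(h))] to [a p(b) ⊗ gam(h)],
which a balanced morphism does not distinguish from [a ⊗ p(b) gam(h)]. *)
Lemma can'_coequaliser : is_tensor_over p (can' coaction).
Proof.
  split.
  - strictify. rw mA. rw coaction_linear. close.
  - intros z h hz. exists (h ∘ (\id A ⊠ gam) ∘ Phi'). split.
    + assert (e : (\id A ⊠ (mul A ∘ (p ⊠ gam))) ∘ (\id A ⊠ Ji) = \id _).
      { rewrite <- whisk_comp, JJi, whisk_id. reflexivity. }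
      apply (epi_of_section e).
      assert (c : can' coaction ∘ (\id A ⊠ (mul A ∘ (p ⊠ gam)))
        = twist (comul H) gam ∘ ((mul A ∘ (\id A ⊠ p)) ⊠ \id H) ∘ assocV A B H).
      { rewrite <- can'_gam. strictify.
        lhs (rw coaction_linear; rwl mA). close. }
      rewrite <- !compA, c, (compA Phi'), PhiK, comp1m.
      strictify. rw hz. close.
    + intros k <-. rewrite <- compA, can'_section. apply compm1.
Qed.

Lemma cleft_galois : 
  exists (psi : A ~> A ⊗ H) (p : B ~> A),
      is_comodule_algebra psi /\
      is_coinvariants psi p /\
      (exists (Q : C) (q : A ⊗ A ~> Q),
          is_tensor_over p q /\
          is_galois psi q /\
          is_split_epi q) /\
      has_normal_basis psi p.
Proof.
  exists coaction, p.
  split; [exact (conj coaction_comodule (conj coaction_mul coaction_one))|].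
  split; [exact coaction_coinvariants|]. split.
  - exists (A ⊗ H), (can' coaction). split; [exact can'_coequaliser|]. split.
    + exists (\id _). split; [apply is_iso_id | apply comp1m].
    + exists ((\id A ⊠ gam) ∘ Phi'). exact can'_section.
  - exists Ji. split; [exact (is_iso_sym JiJ JJi)|]. split.
    + apply (mono_of_retraction JiJ).
      unfold restricted_action, free_action.
      rewrite (compA (mul A ∘ (p ⊠ gam))), JJi, comp1m.
      strictify. rw pm. rw mA. rw JJi. close.
    + unfold is_comodule_morphism, coaction.
      rewrite !compA, <- comp_rwhisk, JiJ, tensm_id, comp1m. reflexivity.
Qed.

End Galois.

(** * From Galois extensions with a normal basis to cleft extensions *)

Section NormalBasis.
Variables (C : braided_category) (H : hopf_algebra C) (A B : algebra C).
Variables (psi : A ~> A ⊗ H) (p : B ~> A).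
Hypothesis psiP : is_comodule_algebra psi.
Hypothesis coinvP : is_coinvariants psi p.
Variables (Q : C) (q : A ⊗ A ~> Q).
Hypothesis tensorP : is_tensor_over p q.
Hypothesis galoisP : is_galois psi q.

Let pm : p ∘ mul B = mul A ∘ (p ⊠ p) := proj1 (proj1 coinvP).
Let pu : p ∘ one B = one A := proj2 (proj1 coinvP).
Let psim : psi ∘ mul A = (mul A ⊠ mul H) ∘ interchange A H A H ∘ (psi ⊠ psi) := proj1 (proj2 psiP).
Let psiu : psi ∘ one A = (one A ⊠ one H) ∘ lunitV \I := proj2 (proj2 psiP).
Let mA := algA (algP A).

Lemma coaction_base : psi ∘ p = (\id A ⊠ one H) ∘ runitV A ∘ p.
Proof. rewrite (proj1 (proj2 coinvP)), <- compA. reflexivity. Qed.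

Lemma coinvariants_mono x (f g : x ~> B) : p ∘ f = p ∘ g -> f = g.
Proof.
  intros h.
  destruct (proj2 (proj2 coinvP) x (p ∘ g)) as (k & _ & u).
  { rewrite !compA, (proj1 (proj2 coinvP)). reflexivity. }
  rewrite <- (u f h). apply u. reflexivity.
Qed.

Section Basis.
Variables (theta : A ~> B ⊗ H) (thetaV : B ⊗ H ~> A).
Hypothesis tVt : thetaV ∘ theta = \id A.
Hypothesis ttV : theta ∘ thetaV = \id (B ⊗ H).
Hypothesis thetal : theta ∘ restricted_action p = free_action H B ∘ (\id B ⊠ theta).
Hypothesis thetac : cofree_coaction H B ∘ theta = (theta ⊠ \id H) ∘ psi.

Definition basis_section : H ~> A := thetaV ∘ (one B ⊠ \id H) ∘ lunitV H.
Notation gam := basis_section.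

Lemma basis_section_basis : mul A ∘ (p ⊠ gam) = thetaV.
Proof.
  apply (mono_of_retraction tVt). rewrite ttV.
  unfold basis_section. strictify. rw thetal. rw ttV. rw (algm1 (algP B)). close.
Qed.

Lemma basis_section_colinear : psi ∘ gam = (gam ⊠ \id H) ∘ comul H.
Proof.
  assert (e : (theta ⊠ \id H) ∘ psi ∘ gam = (theta ⊠ \id H) ∘ (gam ⊠ \id H) ∘ comul H).
  { rewrite !compA, <- thetac. unfold basis_section. strictify. rw ttV. rw ttV. close. }
  assert (i : (thetaV ⊠ \id H) ∘ (theta ⊠ \id H) = \id _).
  { rewrite <- comp_rwhisk, tVt. apply tensm_id. }
  exact (mono_of_retraction i e).
Qed.

Lemma theta_basis_section : theta ∘ gam = (one B ⊠ \id H) ∘ lunitV H.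
Proof. unfold basis_section. rewrite compA, ttV, comp1m. reflexivity. Qed.

Lemma base_part_coaction : (base_part theta ⊠ \id H) ∘ psi = theta.
Proof.
  unfold base_part. strictify. rwl thetac. rw (@counitl _ H). close.
Qed.

(** The coordinates of [a] in the basis are [base_part(a0) ⊗ a1], by colinearity
and the counit; hence [a = p(base_part(a0)) gam(a1)]. *)
Lemma basis_section_decomposition : mul A ∘ ((p ∘ base_part theta) ⊠ gam) ∘ psi = \id A.
Proof.
  apply (eq_trans (y := (mul A ∘ (p ⊠ gam)) ∘ (base_part theta ⊠ \id H) ∘ psi)).
  - strictify. close.
  - rewrite base_part_coaction, basis_section_basis. exact tVt.
Qed.

(** Since [A] is [B ⊗ H] as a left [B]-module, its tensor product over [B] with
[A] is [A ⊗ H], through [a ⊗ h |-> q(a ⊗ gam(h))]; composed with [can] this is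
the twist of [gam]. The inverse is induced by
[a ⊗ p(b) gam(h) |-> a p(b) ⊗ h]. *)
Lemma basis_section_galois : is_iso (twist (comul H) gam).
Proof.
  destruct galoisP as (can & cani & canq).
  assert (e : twist (comul H) gam = can ∘ q ∘ (\id A ⊠ gam)).
  { rewrite compA, canq. unfold twist. strictify. rw basis_section_colinear. close. }
  rewrite e. apply is_iso_comp; [exact cani|].
  destruct tensorP as [qb qu].
  set (r' := (mul A ⊠ \id H) ∘ assocV A A H ∘ (\id A ⊠ ((p ⊠ \id H) ∘ theta))).
  destruct (qu (A ⊗ H) r') as (r & rq & _).
  { unfold r'. strictify. rw thetal. rw pm. rw mA. close. }
  exists r. split.
  - rewrite compA, rq. unfold r'. strictify. rw theta_basis_section. rw pu. rw (algm1 (algP A)). close.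
  - assert (k : ((q ∘ (\id A ⊠ gam)) ∘ r) ∘ q = q).
    { rewrite <- compA, rq. unfold r'.
      apply (eq_trans (y := q ∘ (\id A ⊠ ((mul A ∘ (p ⊠ gam)) ∘ theta)))).
      - strictify. rw qb. close.
      - rewrite basis_section_basis, tVt, whisk_id. apply compm1. }
    destruct (qu Q q qb) as (i & _ & u).
    rewrite <- (u _ k). apply u. apply comp1m.
Qed.

Hypothesis theta_one : theta ∘ one A = (one B ⊠ one H) ∘ lunitV \I.

Lemma basis_section_one : gam ∘ one H = one A.
Proof.
  apply (mono_of_retraction tVt). rewrite theta_one. strictify. rw theta_basis_section. close.
Qed.

(** The two commutation relations are the decomposition above applied to the
products [gam(h) p(b)] and [gam(h) gam(k)], whose coactions are known because
the coaction is multiplicative. *)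
Lemma normal_basis_cleft : is_cleft p gam
  (base_part theta ∘ mul A ∘ (gam ⊠ p)) (base_part theta ∘ mul A ∘ (gam ⊠ gam)).
Proof.
  split.
  - exact (proj1 coinvP).
  - exact basis_section_one.
  - rewrite basis_section_basis. exact (is_iso_sym tVt ttV).
  - apply (eq_trans (y := (mul A ∘ ((p ∘ base_part theta) ⊠ gam) ∘ psi) ∘ mul A ∘ (gam ⊠ p))).
    + rewrite basis_section_decomposition, comp1m. reflexivity.
    + strictify. rw psim. rw basis_section_colinear. rw coaction_base. rw (algm1 (algP H)).
      postpone' p H. close.
  - apply (eq_trans (y := (mul A ∘ ((p ∘ base_part theta) ⊠ gam) ∘ psi) ∘ mul A ∘ (gam ⊠ gam))).
    + rewrite basis_section_decomposition, comp1m. reflexivity.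
    + strictify. rw psim. do 2 rw basis_section_colinear. postpone' basis_section H. close.
Qed.

End Basis.

(** A normal basis sends the unit to [c ⊗ 1] for some [c] in [B], while
[gam(1) = p(d)] is coinvariant. The decomposition of the unit gives [c d = 1].
As [p(d) p(c) gam(1) = gam(1)], the twist of [gam] takes the same value on
[p(d) p(c) ⊗ 1] and on [1 ⊗ 1], and being a monomorphism it gives [d c = 1].
Right multiplication by [d] on the factor [B] of [B ⊗ H] then corrects the basis. *)
Lemma unital_normal_basis :
  has_normal_basis psi p ->
  exists theta : A ~> B ⊗ H,
    is_iso theta /\
    theta ∘ restricted_action p = free_action H B ∘ (\id B ⊠ theta) /\
    cofree_coaction H B ∘ theta = (theta ⊠ \id H) ∘ psi /\
    theta ∘ one A = (one B ⊠ one H) ∘ lunitV \I.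
Proof.
  intros (theta & (thetaV & tVt & ttV) & thl & thc).
  unfold is_module_morphism in thl. unfold is_comodule_morphism in thc.
  set (gam := basis_section thetaV).
  set (c := base_part theta ∘ one A).
  assert (psig : psi ∘ gam = (gam ⊠ \id H) ∘ comul H) by exact (basis_section_colinear tVt ttV thc).
  destruct (proj2 (proj2 coinvP) \I (gam ∘ one H)) as (d & pd & _).
  { strictify. rw psig. rw (@comul_one _ H). close. }
  assert (thu : theta ∘ one A = (c ⊠ one H) ∘ lunitV \I).
  { unfold c. strictify. lhs (rwl (base_part_coaction thc); rw psiu). close. }
  assert (cd : mul B ∘ (c ⊠ d) ∘ lunitV \I = one B).
  { apply coinvariants_mono. rewrite pu.
    apply (eq_trans (y := (mul A ∘ ((p ∘ base_part theta) ⊠ gam) ∘ psi) ∘ one A)).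
    - unfold c. strictify. rw pm. rw pd. rw psiu. close.
    - assert (dec : mul A ∘ ((p ∘ base_part theta) ⊠ gam) ∘ psi = \id A)
        by exact (basis_section_decomposition tVt ttV thl thc).
      rewrite dec. apply comp1m. }
  assert (dc : mul B ∘ (d ⊠ c) ∘ lunitV \I = one B).
  { apply coinvariants_mono.
    destruct (basis_section_galois tVt ttV thl thc) as (Phi' & PhiK & _).
    set (e := p ∘ mul B ∘ (d ⊠ c) ∘ lunitV \I).
    assert (k : twist (comul H) gam ∘ (e ⊠ one H) ∘ lunitV \I
      = twist (comul H) gam ∘ (one A ⊠ one H) ∘ lunitV \I).
    { unfold twist, e. strictify. rw (@comul_one _ H). rwl pd. rw (alg1m (algP A)).
      rwl pm. rw (algA (algP B)). rw cd. rw (algm1 (algP B)). close. }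
    apply (mono_of_retraction PhiK) in k.
    apply (f_equal (fun f => runit A ∘ (\id A ⊠ counit H) ∘ f)) in k.
    rewrite pu. fold e.
    apply (eq_trans (y := runit A ∘ (\id A ⊠ counit H) ∘ (e ⊠ one H) ∘ lunitV \I)).
    - clearbody e. strictify. rw (@counit_one _ H). close.
    - rewrite k. strictify. rw (@counit_one _ H). close. }
  set (R := fun x : \I ~> B => (mul B ⊠ \id H) ∘ assocV B B H ∘ (\id B ⊠ ((x ⊠ \id H) ∘ lunitV H))).
  assert (RR : forall x y, mul B ∘ (x ⊠ y) ∘ lunitV \I = one B -> R y ∘ R x = \id _).
  { intros x y xy. unfold R. strictify. rw (algA (algP B)). rw xy. rw (algm1 (algP B)). close. }
  exists (R d ∘ theta). split; [|split; [|split]].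
  - apply is_iso_comp; [|exists thetaV; split; assumption].
    exists (R c). split; apply RR; assumption.
  - unfold R. strictify. rw thl. rw (algA (algP B)). close.
  - unfold R. strictify. rw thc. close.
  - unfold R. strictify. rw thu. rw cd. close.
Qed.

Lemma galois_cleft : has_normal_basis psi p -> cleft_extension H A B.
Proof.
  intros h. destruct (unital_normal_basis h) as (theta & (thetaV & tVt & ttV) & thl & thc & thu).
  assert (cl := normal_basis_cleft tVt ttV thl thc thu).
  exists p, (basis_section thetaV), (base_part theta ∘ mul A ∘ (basis_section thetaV ⊠ p)),
    (base_part theta ∘ mul A ∘ (basis_section thetaV ⊠ basis_section thetaV)).
  split; [exact cl|].
  exact (proj2 (twist_invertible cl) (basis_section_galois tVt ttV thl thc)).
Qed.

End NormalBasis.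

Theorem theorem1p3 (C : braided_category)
    (equalisers : has_equalisers C) (coequalisers : has_coequalisers C)
    (H : hopf_algebra C) (A B : algebra C) :
  (exists (alpha : H ⊗ B ~> B) (sigma : H ⊗ H ~> B),
      is_weak_action alpha /\
      is_cocycle alpha sigma /\
      is_convolution_invertible sigma /\
      exists assoc_unital : is_algebra (crossed_mul alpha sigma) (crossed_one H B),
        algebra_isomorphic A (crossed_product assoc_unital))
  <->
  (exists (psi : A ~> A ⊗ H) (p : B ~> A),
      is_comodule_algebra psi /\
      is_coinvariants psi p /\
      (exists (Q : C) (q : A ⊗ A ~> Q),
          is_tensor_over p q /\
          is_galois psi q /\
          is_split_epi q) /\
      has_normal_basis psi p).
Proof.
  split.
  - intros h.
    destruct (proj1 (crossed_productP H A B) h) as (p & gam & alpha & sigma & cl & inv).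
    destruct (cleft_iso cl) as (Ji & JiJ & JJi).
    destruct (proj1 (twist_invertible cl) inv) as (Phi' & PhiK & PhiK').
    exact (cleft_galois cl JiJ JJi PhiK PhiK').
  - intros (psi & p & psiP & coinvP & (Q & q & tensorP & galoisP & _) & basis).
    apply (proj2 (crossed_productP H A B)).
    exact (galois_cleft psiP coinvP tensorP galoisP basis).
Qed.
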